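(* (1) The indecomposable graded Cohen–Macaulay $\Lambda$-modules are, up to isomorphism, exactly the pairwise non-isomorphic modules $(i,j)$ with $i,j\in\mathbb Z$, $0<j-i<n$; the projective-injective ones are those of the form $(i,i+1)$ and $(i,i+n-1)$, $i\in\mathbb Z$. (2) The non-split extensions of indecomposable graded Cohen–Macaulay $\Lambda$-modules are of the form $0\to(s,t)\to(s,t')\oplus(s',t)\to(s',t')\to0$ with $s<s'<t<t'<s+n$. (3) For every non-projective indecomposable $(i,j)$, the Auslander–Reiten sequence ending at $(i,j)$ in $\mathrm{CM}^{\mathbb Z}(\Lambda)$ is $0\to(i-1,j-1)\to(i-1,j)\oplus(i,j-1)\to(i,j)\to0$. (4) The Auslander–Reiten quiver of $\mathrm{CM}^{\mathbb Z}(\Lambda)$ has vertices $(i,j)$, $0<j-i<n$, and arrows $(i,j)\to(i+1,j)$ and $(i,j)\to(i,j+1)$ whenever the target lies in this range.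
   Context: $K$ a field, $R=K[x]$, $n\ge3$. $\Lambda\subset M_n(K[x,x^{-1}])$ is the $R$-order with $(i,j)$ entry $x^{c_{ij}}R$, $c_{ij}=0$ for $i\le j$ except $c_{1n}=-1$, $c_{ij}=1$ for $i=j+1$, $c_{ij}=2$ for $i\ge j+2$, graded by $\Lambda_m=\Lambda\cap M_n(Kx^m)$. $\mathrm{CM}^{\mathbb Z}(\Lambda)$: graded left $\Lambda$-modules, finitely generated and free over $R$, with degree-preserving morphisms. Grade shift: $X(m)_k=X_{m+k}$. For $1\le i<j\le n$, $(i,j)$ is the graded module $[R^{i}\,(x)^{j-i}\,(x^2)^{n-j}]^t\subset K[x,x^{-1}]^n$ (column vectors, $\deg x=1$); for $k\in\mathbb Z$ put $(i+kn,j+kn):=(i,j)(2k)$ and $(j+kn,i+(k+1)n):=(i,j)(2k+1)$, which defines $(a,b)$ for all integers with $0<b-a<n$. *)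

(* Defs.v *)
From HB Require Import structures.
From mathcomp Require Import all_boot all_order all_algebra.
Set Implicit Arguments. Unset Strict Implicit. Unset Printing Implicit Defensive.
Import Order.TTheory GRing.Theory Num.Theory.
Local Open Scope ring_scope.

Section Lambda.
Variables (K : fieldType) (n : nat).

(* exponents c_{kl}; k,l : 'I_n are 0-indexed (paper index = k+1) *)
Definition cc (k l : 'I_n) : int :=
  if (k <= l)%N then
    (if ((nat_of_ord k == 0) && (nat_of_ord l == n.-1))%N then -1 else 0)
  else if (nat_of_ord k == (nat_of_ord l).+1)%N then 1 else 2.

(* x^{c_jk} e_jk * x^{c_kl} e_kl = x^{ee j k l} * (x^{c_jl} e_jl) *)
Definition ee (j k l : 'I_n) : nat := absz (cc j k + cc k l - cc j l)%R.

(* A graded Lambda-module which is f.g. free over R = K[x]: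
   each e_k X is graded free over R with rank (rk k) and homogeneous basis
   of degrees (gdeg k); the generator a_{kl} = x^{c_kl} e_{kl} of Lambda acts
   e_l X -> e_k X by v |-> v *m act k l (coordinates = row vectors over R). *)
Record gmod := GMod {
  rk : 'I_n -> nat;
  gdeg : forall k, 'I_(rk k) -> int;
  act : forall k l : 'I_n, 'M[{poly K}]_(rk l, rk k) }.

Definition homog (p : {poly K}) (d : int) : Prop :=
  forall i : nat, p`_i != 0 -> i%:Z = d.

Definition is_cm (X : gmod) : Prop :=
  [/\ forall k l p q, homog (act X k l p q) (@gdeg X l p + cc k l - @gdeg X k q),
      forall k, act X k k = 1%:M
    & forall j k l, act X k l *m act X j k = 'X^(ee j k l) *: act X j l].

(* degree-preserving Lambda-linear maps, componentwise on e_l X *)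
Definition ghom (X Y : gmod) := forall l : 'I_n, 'M[{poly K}]_(rk X l, rk Y l).

Definition is_hom (X Y : gmod) (F : ghom X Y) : Prop :=
  (forall l p q, homog (F l p q) (@gdeg X l p - @gdeg Y l q)) /\
  (forall k l, act X k l *m F k = F l *m act Y k l).

Definition idh (X : gmod) : ghom X X := fun l => 1%:M.
Definition zeroh (X Y : gmod) : ghom X Y := fun l => 0.
Definition comp (X Y Z : gmod) (F : ghom X Y) (G : ghom Y Z) : ghom X Z :=
  fun l => F l *m G l.
Definition addh (X Y : gmod) (F G : ghom X Y) : ghom X Y := fun l => F l + G l.
Definition subh (X Y : gmod) (F G : ghom X Y) : ghom X Y := fun l => F l - G l.
Definition scaleh (X Y : gmod) (c : K) (F : ghom X Y) : ghom X Y :=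
  fun l => c%:P *: F l.

Definition iso (X Y : gmod) : Prop :=
  exists (F : ghom X Y) (G : ghom Y X),
    [/\ is_hom F, is_hom G, comp F G = idh X & comp G F = idh Y].

Definition is_zero (X : gmod) : Prop := forall k, rk X k = 0%N.

Definition is_biprod (X Y1 Y2 : gmod) : Prop :=
  exists (i1 : ghom Y1 X) (i2 : ghom Y2 X) (p1 : ghom X Y1) (p2 : ghom X Y2),
    [/\ is_hom i1 /\ is_hom i2 /\ is_hom p1 /\ is_hom p2,
        comp i1 p1 = idh Y1, comp i2 p2 = idh Y2,
        comp i1 p2 = zeroh Y1 Y2 /\ comp i2 p1 = zeroh Y2 Y1
      & addh (comp p1 i1) (comp p2 i2) = idh X].

Definition indec (X : gmod) : Prop :=
  [/\ is_cm X, ~ is_zero X &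
      forall Y1 Y2, is_cm Y1 -> is_cm Y2 -> is_biprod X Y1 Y2 ->
        is_zero Y1 \/ is_zero Y2].

Definition ses (A B C : gmod) (f : ghom A B) (g : ghom B C) : Prop :=
  [/\ is_cm A /\ is_cm B /\ is_cm C, is_hom f, is_hom g &
      forall l,
      [/\ forall v : 'rV[{poly K}]_(rk A l), v *m f l = 0 -> v = 0,
          forall w : 'rV[{poly K}]_(rk C l), exists v, v *m g l = w
        & forall v : 'rV[{poly K}]_(rk B l),
            v *m g l = 0 <-> exists u : 'rV[{poly K}]_(rk A l), u *m f l = v]].

Definition split_mono (A B : gmod) (f : ghom A B) : Prop :=
  exists r : ghom B A, is_hom r /\ comp f r = idh A.
Definition split_epi (B C : gmod) (g : ghom B C) : Prop :=
  exists s : ghom C B, is_hom s /\ comp s g = idh C.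

Definition projectiveCM (P : gmod) : Prop :=
  is_cm P /\
  forall A B C (f : ghom A B) (g : ghom B C), ses f g ->
    forall h : ghom P C, is_hom h ->
      exists h' : ghom P B, is_hom h' /\ comp h' g = h.
Definition injectiveCM (I : gmod) : Prop :=
  is_cm I /\
  forall A B C (f : ghom A B) (g : ghom B C), ses f g ->
    forall h : ghom A I, is_hom h ->
      exists h' : ghom B I, is_hom h' /\ comp f h' = h.

Definition right_almost_split (B C : gmod) (g : ghom B C) : Prop :=
  ~ split_epi g /\
  forall W (h : ghom W C), is_cm W -> is_hom h -> ~ split_epi h ->
    exists h' : ghom W B, is_hom h' /\ comp h' g = h.
Definition left_almost_split (A B : gmod) (f : ghom A B) : Prop :=
  ~ split_mono f /\
  forall W (h : ghom A W), is_cm W -> is_hom h -> ~ split_mono h ->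
    exists h' : ghom B W, is_hom h' /\ comp f h' = h.
Definition almost_split (A B C : gmod) (f : ghom A B) (g : ghom B C) : Prop :=
  [/\ ses f g, left_almost_split f & right_almost_split g].

Definition in_rad (X Y : gmod) (f : ghom X Y) : Prop :=
  is_hom f /\
  forall g : ghom Y X, is_hom g ->
    exists u : ghom X X, [/\ is_hom u,
      comp (subh (idh X) (comp f g)) u = idh X &
      comp u (subh (idh X) (comp f g)) = idh X].
Definition in_rad2 (X Y : gmod) (f : ghom X Y) : Prop :=
  exists (m : nat) (Z : 'I_m -> gmod)
         (f1 : forall t, ghom X (Z t)) (f2 : forall t, ghom (Z t) Y),
    (forall t, [/\ is_cm (Z t), in_rad (f1 t) & in_rad (f2 t)]) /\
    f = (fun l => \sum_(t < m) (f1 t l *m f2 t l)).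

(* dim_K rad(X,Y)/rad^2(X,Y) = 0, resp. = 1 (number of AR-quiver arrows) *)
Definition irr_dim0 (X Y : gmod) : Prop :=
  forall f : ghom X Y, in_rad f -> in_rad2 f.
Definition irr_dim1 (X Y : gmod) : Prop :=
  exists f0 : ghom X Y, [/\ in_rad f0, ~ in_rad2 f0 &
    forall f : ghom X Y, in_rad f -> exists c : K, in_rad2 (subh f (scaleh c f0))].

(* modules with all e_k X of rank one: e_k X = x^{d k} R inside K[x,x^-1] *)
Definition lat (d : 'I_n -> int) : gmod :=
  @GMod (fun _ => 1%N) (fun k _ => d k)
        (fun k l => const_mx ('X^(absz (cc k l + d l - d k)%R))).

(* grade shift X(m), X(m)_k = X_{m+k} *)
Definition shiftg (X : gmod) (m : int) : gmod :=
  @GMod (rk X) (fun k p => @gdeg X k p - m) (act X).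

(* (i,j) for 1 <= i < j <= n : [R^i (x)^{j-i} (x^2)^{n-j}]^t *)
Definition base_deg (i j : int) (k : 'I_n) : int :=
  let p := (k.+1)%:Z in if p <= i then 0 else if p <= j then 1 else 2.

(* (a,b) for 0 < b - a < n:  (i+qn, j+qn) = (i,j)(2q),
   (j+qn, i+(q+1)n) = (i,j)(2q+1), with 1 <= i < j <= n *)
Definition mod_ab (a b : int) : gmod :=
  let q := divz (a - 1) n%:Z in
  let i := a - q * n%:Z in
  if b - q * n%:Z <= n%:Z then shiftg (lat (base_deg i (b - q * n%:Z))) (2 * q)
  else shiftg (lat (base_deg (b - (q + 1) * n%:Z) i)) (2 * q + 1).

End Lambda.

(* Main.v *)
(** Specializing at x = 1 turns a graded Cohen-Macaulay module into a finite
    dimensional space V with two decreasing Z-indexed filtrations A and B such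
    that A_k is contained in B_(k+1) and B_(k+n-1) in A_k; degree-preserving maps
    become filtered linear maps, and short exact sequences become strictly exact
    ones.  The module (a,b) is the line with A_k nonzero iff k <= a and B_k nonzero
    iff k <= b, so a map from (a,b) to X is a vector of A_a /\ B_b, and a map from X
    to (a,b) is a functional killing A_(a+1) + B_(b+1).  If a is the last index with
    A_a <> 0 and b the last one with A_a /\ B_b <> 0, a vector of A_a /\ B_b outside
    B_(b+1) spans a direct summand (a,b).  Moreover a map (a,b) -> X is not a split
    mono iff its vector lies in A_(a+1) + B_(b+1), and a map X -> (a,b) is not a split
    epi iff its functional kills A_a /\ B_b; both factorizations of an almost split
    sequence, and the vanishing of rad^2 along the arrows, follow by decomposing
    vectors and functionals accordingly. *)

Require Import Defs.
From HB Require Import structures.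
From mathcomp Require Import all_boot all_order all_algebra.
From mathcomp Require Import zify ring.
From Stdlib Require Import FunctionalExtensionality.
Import Defs.
Set Implicit Arguments. Unset Strict Implicit. Unset Printing Implicit Defensive.
Import Order.TTheory GRing.Theory Num.Theory.
Local Open Scope ring_scope.

(** Specializing loses nothing because a homogeneous polynomial of known degree is determined by its
    value at 1, and a nonzero value is possible exactly when that degree is nonnegative; this
    condition is what the filtrations record. All fibres at x = 1 are identified with the one at a
    fixed vertex [o]. The index k of a filtration runs periodically through the vertices 1, ..., n,
    the degree dropping by 2 at each turn, and the two filtrations belong to the two parities of the
    degree. Their interleaving comes from the entries x e_(i+1,i) and x^-1 e_(1,n) of the order,
    which move to the next vertex and change the parity. Two features of the definitions shape the
    work. A module is a family of explicit homogeneous bases, so a direct summand exists only once a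
    homogeneous basis of a complement has been built. Exactness is stated for arbitrary rows of
    polynomials, so homogeneous components have to be extracted before it says anything about
    filtrations. *)

Notation ev := (map_mx (horner_eval 1)).

(** * Homogeneous polynomial matrices and their values at x = 1 *)

Section HomogeneousMatrices.
Variable K : fieldType.

Lemma homogE (p : {poly K}) d : homog p d -> p = if 0 <= d then p.[1] *: 'X^(absz d) else 0.
Proof.
move=> hp; case: ifP => hd; last first.
  apply/polyP=> i; rewrite coef0; apply/eqP/negPn/negP => /hp; lia.
have hc i : (i != absz d)%N -> p`_i = 0.
  by move=> hi; apply/eqP/negPn/negP => /hp; lia.
have -> : p.[1] = p`_(absz d).
  rewrite (@horner_coef_wide _ (maxn (size p) (absz d).+1)) ?leq_maxl //.
  have hlt : (absz d < maxn (size p) (absz d).+1)%N by rewrite leq_max ltnSn orbT.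
  rewrite (bigD1 (Ordinal hlt)) //= expr1n mulr1 big1 ?addr0 // => i hi.
  by rewrite hc ?mul0r.
apply/polyP=> i; rewrite coefZ coefXn; case: eqP => [->|/eqP /hc ->].
  by rewrite mulr1.
by rewrite mulr0.
Qed.

Lemma homog_neg (p : {poly K}) d : homog p d -> p.[1] != 0 -> 0 <= d.
Proof. by move=> /homogE ->; case: ifP => //; rewrite horner0 eqxx. Qed.

Lemma homog_inj (p q : {poly K}) d : homog p d -> homog q d -> p.[1] = q.[1] -> p = q.
Proof. by move=> /homogE -> /homogE ->; case: ifP => // _; rewrite !hornerZ !hornerXn !expr1n !mulr1 => ->. Qed.

Lemma homog0 d : homog (0 : {poly K}) d.
Proof. by move=> i; rewrite coef0 eqxx. Qed.

Lemma homogD (p q : {poly K}) d : homog p d -> homog q d -> homog (p + q) d.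
Proof.
move=> hp hq i; rewrite coefD => h; have [p0|/hp//] := eqVneq p`_i 0.
by apply: hq; rewrite p0 add0r in h.
Qed.

Lemma homog_sum (I : finType) (F : I -> {poly K}) d :
  (forall i, homog (F i) d) -> homog (\sum_i F i) d.
Proof. by move=> hF; apply: (big_ind (fun p => homog p d)) => //; [exact: homog0 | move=> x y; exact: homogD]. Qed.

Lemma homogM (p q : {poly K}) d e : homog p d -> homog q e -> homog (p * q) (d + e).
Proof.
move=> hp hq i; rewrite coefM; move=> h; apply/eqP; apply: contraNT h => h; rewrite big1 // => j _.
have [-> |/hp hj] := eqVneq p`_j 0; first by rewrite mul0r.
have [-> |/hq hk] := eqVneq q`_(i - j) 0; first by rewrite mulr0.
have := ltn_ord j; move: h; lia.
Qed.

Lemma homogZX c d (m : nat) : (c != 0 -> m%:Z = d) -> homog (c *: 'X^m : {poly K}) d.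
Proof.
move=> h i; rewrite coefZ coefXn; have [->|_] := eqVneq i m; last by rewrite mulr0 eqxx.
by rewrite mulr1 => /h.
Qed.

Definition hmx m p (a : 'I_m -> int) (b : 'I_p -> int) (A : 'M[{poly K}]_(m, p)) :=
  forall i j, homog (A i j) (a i - b j).

Lemma hmxM m p r (a : 'I_m -> int) (b : 'I_p -> int) (c : 'I_r -> int) A B :
  hmx a b A -> hmx b c B -> hmx a c (A *m B).
Proof.
move=> hA hB i j; rewrite mxE; apply: homog_sum => k.
by have := homogM (hA i k) (hB k j); rewrite addrA subrK.
Qed.

Lemma hmx_inj m p (a : 'I_m -> int) (b : 'I_p -> int) A B :
  hmx a b A -> hmx a b B -> ev A = ev B -> A = B.
Proof.
move=> hA hB /matrixP h; apply/matrixP=> i j.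
by apply: homog_inj (hA i j) (hB i j) _; have := h i j; rewrite !mxE.
Qed.

Lemma hmx_shift m p (a : 'I_m -> int) (b : 'I_p -> int) c A :
  hmx a b A -> hmx (fun i => a i + c) (fun i => b i + c) A.
Proof. by move=> h i j; have -> : a i + c - (b j + c) = a i - b j by ring. Qed.

(* The row of a homogeneous element of degree [d] specializing to [v] at [x = 1]. *)
Definition hrow m (b : 'I_m -> int) (d : int) (v : 'rV[K]_m) : 'rV[{poly K}]_m :=
  \row_q (v 0 q *: 'X^(absz (d - b q))).

(* The part of degree [d] of a row of polynomials, specialized at [x = 1]. *)
Definition cfrow m (b : 'I_m -> int) (d : int) (y : 'rV[{poly K}]_m) : 'rV[K]_m :=
  \row_q (if b q <= d then (y 0 q)`_(absz (d - b q)) else 0).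

Definition supp m (b : 'I_m -> int) (d : int) (v : 'rV[K]_m) :=
  [forall q, (v 0 q != 0) ==> (b q <= d)].

Lemma suppP m (b : 'I_m -> int) d (v : 'rV[K]_m) :
  reflect (forall q, v 0 q != 0 -> b q <= d) (supp b d v).
Proof. by apply: (iffP forallP) => h q; apply/implyP/h. Qed.

Lemma supp_cfrow m (b : 'I_m -> int) d y : supp b d (cfrow b d y).
Proof. by apply/suppP=> q; rewrite mxE; case: ifP => // _; rewrite eqxx. Qed.

Lemma ev_hrow m (b : 'I_m -> int) d v : ev (hrow b d v) = v.
Proof. by apply/matrixP=> i j; rewrite !mxE /horner_eval hornerZ hornerXn expr1n mulr1 ord1. Qed.

Lemma hmx_hrow m (b : 'I_m -> int) d v :
  supp b d v -> hmx (fun _ : 'I_1 => d) b (hrow b d v).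
Proof. by move/suppP=> h i j; rewrite mxE; apply: homogZX => /h; lia. Qed.

Lemma cfrow_hrow m (b : 'I_m -> int) d v : supp b d v -> cfrow b d (hrow b d v) = v.
Proof.
move/suppP=> h; apply/rowP=> q; rewrite !mxE coefZ coefXn eqxx mulr1.
by case: ifP => // hq; apply/esym/eqP/negPn/negP => /h; rewrite hq.
Qed.

(** Turns an arbitrary preimage of a homogeneous row into a homogeneous one, as needed to extract
    strict exactness from [ses]. *)
Lemma cfrowM m p (a : 'I_m -> int) (b : 'I_p -> int) d y A :
  hmx a b A -> cfrow b d (y *m A) = cfrow a d y *m ev A.
Proof.
move=> hA; apply/rowP=> r; rewrite !mxE.
case: ifP => hr; last first.
  rewrite big1 // => q _; rewrite !mxE; case: ifP => hq; last by rewrite mul0r.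
  rewrite /horner_eval (homogE (hA q r)); case: ifP => hqr; first by lia.
  by rewrite horner0 mulr0.
rewrite coef_sum; apply: eq_bigr => q _; rewrite !mxE /horner_eval.
have := homogE (hA q r); case: ifP => hqr -> ; last by rewrite horner0 !mulr0 coef0.
rewrite hornerZ hornerXn expr1n mulr1 -scalerAr coefZ coefMXn mulrC.
case: ifP => hq; first by case: ifP => [|_]; [lia | rewrite mul0r].
case: ifP => hq'; last lia.
congr (_ * _); congr (_`_ _); lia.
Qed.

End HomogeneousMatrices.

(** * The fibre functor at x = 1, full and faithful onto filtered linear maps *)

Section Fibre.
Variables (K : fieldType) (n : nat) (o : 'I_n).
Implicit Types (X Y Z : gmod K n) (l : 'I_n) (d : int).

Definition toO X l : 'M[K]_(rk X l, rk X o) := ev (act X o l).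
Definition fromO X l : 'M[K]_(rk X o, rk X l) := ev (act X l o).

(* The degree [d] part of e_l X, read in the fibre at [x = 1] of e_o X. *)
Definition fl X l d (v : 'rV[K]_(rk X o)) : bool := supp (@gdeg K n X l) d (v *m fromO X l).

Arguments fl : clear implicits.

(** The subspace cut out by [fl], presented as a row space so that sums, intersections and
    annihilators are available. *)
Definition Fl X l d : 'M[K]_(rk X l, rk X o) :=
  diag_mx (\row_p (@gdeg K n X l p <= d)%R%:R) *m toO X l.

Definition filtered X Y (Phi : 'M[K]_(rk X o, rk Y o)) :=
  forall l d v, fl X l d v -> fl Y l d (v *m Phi).

Definition fib X Y (F : ghom X Y) : 'M[K]_(rk X o, rk Y o) := ev (F o).

(** Rehomogenization, inverse to [fib]. For filtered [Phi] an entry whose degree would be negative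
    has coefficient 0, so [absz] does no harm. *)
Definition lift_hom X Y (Phi : 'M[K]_(rk X o, rk Y o)) : ghom X Y :=
  fun l => \matrix_(p, q) ((toO X l *m Phi *m fromO Y l) p q
                           *: 'X^(absz (@gdeg K n X l p - @gdeg K n Y l q))).

Lemma evZX m r (A : 'M[{poly K}]_(m, r)) (k : nat) : ev ('X^k *: A) = ev A.
Proof. by apply/matrixP=> i j; rewrite !mxE /horner_eval hornerM hornerXn expr1n mul1r. Qed.

Lemma ev_act X j k l : is_cm X -> ev (act X k l) *m ev (act X j k) = ev (act X j l).
Proof. by case=> _ _ hX; rewrite -map_mxM hX evZX. Qed.

Lemma ev_actK X k l : is_cm X -> ev (act X k l) *m ev (act X l k) = 1%:M.
Proof. by move=> hX; rewrite ev_act //; case: hX => _ -> _; rewrite map_mx1. Qed.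

Lemma toOK X l : is_cm X -> toO X l *m fromO X l = 1%:M.
Proof. exact: ev_actK. Qed.

Lemma fromOK X l : is_cm X -> fromO X l *m toO X l = 1%:M.
Proof. exact: ev_actK. Qed.

(** The relations between the generators of the order involve only powers of x, so every generator
    acts invertibly at x = 1. *)
Lemma rk_const X k l : is_cm X -> rk X k = rk X l.
Proof.
move=> hX; apply/eqP; rewrite eqn_leq.
have hr i j : (rk X i <= rk X j)%N.
  have := mulmx_max_rank (ev (act X j i)) (ev (act X i j)).
  by rewrite ev_actK // mxrank1.
by rewrite !hr.
Qed.

Lemma hmx_act X k l : is_cm X ->
  hmx (fun p => @gdeg K n X l p + cc k l) (@gdeg K n X k) (act X k l).
Proof. by move=> [h _ _] p q; apply: h. Qed.
Arguments hmx_act [X] k l _ _ _.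

Lemma hmx_hom X Y (F : ghom X Y) l :
  is_hom F -> hmx (@gdeg K n X l) (@gdeg K n Y l) (F l).
Proof. by move=> [h _] p q; apply: h. Qed.
Arguments hmx_hom [X Y F] l _ _ _.

Lemma fl_step X k l d e v : is_cm X -> d + cc k l <= e -> fl X l d v -> fl X k e v.
Proof.
move=> hX hde /suppP hv; apply/suppP=> q.
rewrite /fromO -(ev_act k l o hX) mulmxA mxE; apply: contraNT => hq.
rewrite big1 // => p _; have [->|/hv hp] := eqVneq ((v *m fromO X l) 0 p) 0.
  by rewrite mul0r.
rewrite !mxE; apply/eqP; rewrite mulf_eq0; apply/orP; right.
rewrite /horner_eval; apply: contraNT hq => /(homog_neg (hmx_act k l hX p q)); lia.
Qed.

Lemma flP X l d v : is_cm X -> fl X l d v = (v <= Fl X l d)%MS.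
Proof.
move=> hX; apply/idP/submxP => [/suppP h|[u ->]].
  exists (v *m fromO X l); rewrite /Fl mulmxA mul_mx_diag.
  rewrite -[LHS]mulmx1 -(fromOK l hX) mulmxA; congr (_ *m _).
  apply/matrixP=> i q; rewrite !mxE ord1.
  case: leP => [_|hq]; first by rewrite mulr1.
  rewrite mulr0; apply/eqP; apply/negPn/negP => h0.
  by have := h q; rewrite mxE => /(_ h0); rewrite leNgt hq.
apply/suppP=> q; rewrite /Fl -!mulmxA toOK // mulmx1 mul_mx_diag !mxE.
by case: leP => // _; rewrite mulr0 eqxx.
Qed.

Lemma fib_at X Y (F : ghom X Y) l : is_cm X -> is_cm Y -> is_hom F ->
  ev (F l) = toO X l *m fib F *m fromO Y l.
Proof.
move=> hX hY [_ /(_ o l)] /(congr1 (map_mx (horner_eval 1))).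
by rewrite !map_mxM /toO /fib => ->; rewrite -mulmxA ev_actK // mulmx1.
Qed.

Lemma fib_inj X Y (F G : ghom X Y) : is_cm X -> is_cm Y -> is_hom F -> is_hom G ->
  fib F = fib G -> F = G.
Proof.
move=> hX hY hF hG h; apply: functional_extensionality_dep => l.
by apply: (hmx_inj (hmx_hom l hF) (hmx_hom l hG)); rewrite !fib_at // h.
Qed.

Lemma fib_filtered X Y (F : ghom X Y) : is_cm X -> is_cm Y -> is_hom F -> filtered (fib F).
Proof.
move=> hX hY hF l d v /suppP hv; apply/suppP=> q.
have -> : v *m fib F *m fromO Y l = v *m fromO X l *m ev (F l).
  by rewrite fib_at // !mulmxA -(mulmxA v (fromO _ l)) fromOK // mulmx1.
rewrite mxE; apply: contraNT => hq; rewrite big1 // => p _.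
have [->|/hv hp] := eqVneq ((v *m fromO X l) 0 p) 0; first by rewrite mul0r.
rewrite !mxE; apply/eqP; rewrite mulf_eq0; apply/orP; right.
rewrite /horner_eval; apply: contraNT hq => /(homog_neg (hmx_hom l hF p q)); lia.
Qed.

Section Lift.
Variables (X Y : gmod K n) (Phi : 'M[K]_(rk X o, rk Y o)).
Hypotheses (hX : is_cm X) (hY : is_cm Y) (hPhi : filtered Phi).

Lemma ev_lift_hom l : ev (lift_hom Phi l) = toO X l *m Phi *m fromO Y l.
Proof.
apply/matrixP=> p q; rewrite [LHS]mxE [X in horner_eval 1 X]mxE.
by rewrite /horner_eval hornerZ hornerXn expr1n mulr1.
Qed.

Lemma fib_lift : fib (lift_hom Phi) = Phi.
Proof.
have h1 Z : is_cm Z -> act Z o o = 1%:M by case.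
by rewrite /fib ev_lift_hom /toO /fromO !h1 // !map_mx1 mul1mx mulmx1.
Qed.

Lemma hmx_lift l : hmx (@gdeg K n X l) (@gdeg K n Y l) (lift_hom Phi l).
Proof.
move=> p q; rewrite mxE; apply: homogZX => h.
(* The basis vector [p] lies in the step given by its own degree, so its image only involves basis
   vectors of degree at most that. *)
have hp : fl X l (@gdeg K n X l p) (row p (toO X l)).
  apply/suppP=> r; rewrite -row_mul toOK // !mxE.
  by have [->|_] := eqVneq p r; rewrite // eqxx.
have := suppP _ _ _ (hPhi hp) q; rewrite -!row_mul mxE => /(_ h); lia.
Qed.

Lemma lift_homP : is_hom (lift_hom Phi).
Proof.
split=> [l|k l]; first exact: hmx_lift.
apply: (@hmx_inj K _ _ (fun p => @gdeg K n X l p + cc k l) (@gdeg K n Y k)).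
- exact: hmxM (hmx_act k l hX) (@hmx_lift k).
- exact: hmxM (hmx_shift _ (@hmx_lift l)) (hmx_act k l hY).
rewrite !map_mxM !ev_lift_hom !mulmxA [ev _ *m toO X k]ev_act // -/(toO X l).
by rewrite -[RHS]mulmxA [fromO Y l *m _]ev_act.
Qed.

End Lift.

Lemma fib_comp X Y Z (F : ghom X Y) (G : ghom Y Z) : fib (comp F G) = fib F *m fib G.
Proof. exact: map_mxM. Qed.

Lemma fib_id X : fib (idh X) = 1%:M.
Proof. exact: map_mx1. Qed.

Lemma fib_zero X Y : fib (zeroh X Y) = 0.
Proof. exact: map_mx0. Qed.

Lemma fib_add X Y (F G : ghom X Y) : fib (addh F G) = fib F + fib G.
Proof. exact: map_mxD. Qed.

Lemma fib_sub X Y (F G : ghom X Y) : fib (subh F G) = fib F - fib G.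
Proof. exact: map_mxB. Qed.

Lemma fib_scale X Y c (F : ghom X Y) : fib (scaleh c F) = c *: fib F.
Proof. by apply/matrixP=> i j; rewrite !mxE /horner_eval hornerM hornerC. Qed.

Lemma idh_hom X : is_hom (idh X).
Proof.
split=> [l p q|k l]; last by rewrite /idh mulmx1 mul1mx.
rewrite /idh mxE; case: eqP => [->|_]; last exact: homog0.
by move=> i; rewrite subrr coef1; case: i => // i; rewrite eqxx.
Qed.

Lemma zeroh_hom X Y : is_hom (zeroh X Y).
Proof.
split=> [l p q|k l]; last by rewrite /zeroh mulmx0 mul0mx.
by rewrite /zeroh mxE; exact: homog0.
Qed.

Lemma comp_hom X Y Z (F : ghom X Y) (G : ghom Y Z) : is_hom F -> is_hom G -> is_hom (comp F G).
Proof.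
move=> hF hG; split=> [l|k l]; first exact: hmxM (hmx_hom l hF) (hmx_hom l hG).
by rewrite /comp !mulmxA (proj2 hF) -!mulmxA (proj2 hG).
Qed.

Lemma addh_hom X Y (F G : ghom X Y) : is_hom F -> is_hom G -> is_hom (addh F G).
Proof.
move=> hF hG; split=> [l p q|k l].
  by rewrite /addh mxE; apply: homogD; [exact: hmx_hom hF p q | exact: hmx_hom hG p q].
by rewrite /addh mulmxDr mulmxDl (proj2 hF) (proj2 hG).
Qed.

Lemma scaleh_hom X Y c (F : ghom X Y) : is_hom F -> is_hom (scaleh c F).
Proof.
move=> hF; split=> [l p q i|k l]; last by rewrite /scaleh -scalemxAl -scalemxAr (proj2 hF).
by rewrite /scaleh mxE coefCM mulf_eq0 negb_or => /andP[_]; apply: hmx_hom hF p q i.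
Qed.

Lemma subh_hom X Y (F G : ghom X Y) : is_hom F -> is_hom G -> is_hom (subh F G).
Proof.
move=> hF hG; have -> : subh F G = addh F (scaleh (-1) G).
  apply: functional_extensionality_dep => l.
  by rewrite /subh /addh /scaleh polyCN scaleNr scale1r.
by apply: addh_hom => //; apply: scaleh_hom.
Qed.

(** * Short exact sequences become strictly exact on fibres *)

Section Exact.
Variables (A B C : gmod K n) (f : ghom A B) (g : ghom B C).
Hypothesis hs : ses f g.

Lemma fl_exhaust X : exists D, forall v, fl X o D v.
Proof.
exists (\big[Order.max/0]_q @gdeg K n X o q) => v; apply/suppP => q _.
exact: le_bigmax_cond.
Qed.

Lemma fl_hrowK X l d (v : 'rV_(rk X o)) : is_cm X -> fl X l d v ->
  cfrow (@gdeg K n X l) d (hrow (@gdeg K n X l) d (v *m fromO X l)) *m toO X l = v.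
Proof. by move=> hX h; rewrite cfrow_hrow // -mulmxA fromOK // mulmx1. Qed.

Lemma fl_cfrow X l d y : is_cm X -> fl X l d (cfrow (@gdeg K n X l) d y *m toO X l).
Proof. by move=> hX; rewrite /fl -mulmxA toOK // mulmx1; exact: supp_cfrow. Qed.

Lemma ses_inj (v : 'rV_(rk A o)) : v *m fib f = 0 -> v = 0.
Proof.
move=> h; case: hs => [[hA [hB hC]] hf hg /(_ o) [inj _ _]].
(* In a large enough degree [v] is the value of a homogeneous row, to which the injectivity over
   K[x] applies. *)
have [D /(_ v) /suppP hD] := fl_exhaust A.
have hv : supp (@gdeg K n A o) D v.
  have e1 : fromO A o = 1%:M by rewrite /fromO; case: hA => _ -> _; rewrite map_mx1.
  by apply/suppP => q hq; apply: hD; rewrite e1 mulmx1.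
have h0 : hrow (@gdeg K n A o) D v = 0.
  apply: inj; apply: (@hmx_inj _ _ _ (fun _ => D) (@gdeg K n B o)).
  - exact: hmxM (hmx_hrow hv) (hmx_hom o hf).
  - by move=> i j; rewrite mxE; exact: homog0.
  by rewrite map_mxM ev_hrow map_mx0.
by rewrite -(ev_hrow (@gdeg K n A o) D v) h0 map_mx0.
Qed.

Lemma ses_surj l d w : fl C l d w -> exists2 v, fl B l d v & v *m fib g = w.
Proof.
case: hs => [[hA [hB hC]] hf hg /(_ l) [_ surj _]] hw.
have [y hy] := surj (hrow (@gdeg K n C l) d (w *m fromO C l)).
exists (cfrow (@gdeg K n B l) d y *m toO B l); first exact: fl_cfrow.
have e : toO B l *m fib g = ev (g l) *m toO C l.
  by rewrite fib_at // -!mulmxA fromOK // mulmx1.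
rewrite -mulmxA e mulmxA -(cfrowM d y (hmx_hom l hg)) hy.
exact: fl_hrowK.
Qed.

Lemma ses_ker l d v : fl B l d v -> v *m fib g = 0 -> exists2 u, fl A l d u & u *m fib f = v.
Proof.
case: hs => [[hA [hB hC]] hf hg /(_ l) [_ _ ker]] hv h.
have h0 : hrow (@gdeg K n B l) d (v *m fromO B l) *m g l = 0.
  apply: (@hmx_inj _ _ _ (fun _ => d) (@gdeg K n C l)).
  - exact: hmxM (hmx_hrow hv) (hmx_hom l hg).
  - by move=> i j; rewrite mxE; exact: homog0.
  rewrite map_mxM ev_hrow map_mx0 fib_at // !mulmxA -(mulmxA v (fromO _ l)) fromOK // mulmx1.
  by rewrite h mul0mx.
have [y hy] := proj1 (ker _) h0.
exists (cfrow (@gdeg K n A l) d y *m toO A l); first exact: fl_cfrow.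
have e : toO A l *m fib f = ev (f l) *m toO B l.
  by rewrite fib_at // -!mulmxA fromOK // mulmx1.
rewrite -mulmxA e mulmxA -(cfrowM d y (hmx_hom l hf)) hy.
exact: fl_hrowK.
Qed.

Lemma ses_kerT (v : 'rV_(rk B o)) : v *m fib g = 0 -> exists u, u *m fib f = v.
Proof.
case: (hs) => [[hA [hB hC]] hf hg _].
have [D /(_ v) hv] := fl_exhaust B.
by move=> h; have [u _ hu] := ses_ker hv h; exists u.
Qed.

Lemma ses_comp0 : fib f *m fib g = 0.
Proof.
case: hs => [_ _ _ /(_ o) [_ _ ker]].
rewrite -map_mxM; suff -> : f o *m g o = 0 by rewrite map_mx0.
apply/row_matrixP=> i; rewrite row0 rowE mulmxA; apply/ker.
by eexists.
Qed.

End Exact.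
End Fibre.

Arguments fl {K n} o X l d v.
Arguments hmx_hom {K n X Y F} l _ _ _.
Arguments hmx_act {K n X} k l _ _ _.

Arguments fib {K n} o {X Y} F.

(** * The two interleaved filtrations *)

Section Filtrations.
Variables (K : fieldType) (n : nat) (o : 'I_n).
Hypothesis hn : (3 <= n)%N.
Implicit Types (X Y Z : gmod K n) (e : bool) (k a b : int).

Definition vtx k : 'I_n := insubd o (absz (modz (k - 1) n%:Z)).

Definition fdeg e k : int := (nat_of_bool e)%:Z - 2 * divz (k - 1) n%:Z.

(* [fil X false] and [fil X true] are the even and the odd degree parts of X,
   read off along e_1, ..., e_n periodically: k + n stands for degree lowered by 2. *)
Definition fil X e k (v : 'rV[K]_(rk X o)) : bool := fl o X (vtx k) (fdeg e k) v.
Arguments fil : clear implicits.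

Definition Fil X e k := Fl o X (vtx k) (fdeg e k).

Lemma n_gt0 : (0 : int) < n%:Z. Proof. lia. Qed.

Lemma vtxE (q : int) (r : 'I_n) : vtx (q * n%:Z + r%:Z + 1) = r.
Proof.
apply: val_inj; rewrite /vtx addrK modzMDl modz_small; last by have := ltn_ord r; lia.
by rewrite insubdK //; apply: ltn_ord.
Qed.

Lemma fdegE e (q : int) (r : 'I_n) : fdeg e (q * n%:Z + r%:Z + 1) = (nat_of_bool e)%:Z - 2 * q.
Proof.
rewrite /fdeg addrK divzMDl; last by have := n_gt0; lia.
by rewrite divz_small ?addr0 //; have := ltn_ord r; lia.
Qed.

Lemma index_ex k : exists (q : int) (r : 'I_n), k = q * n%:Z + r%:Z + 1.
Proof.
have hm := ltz_pmod (k - 1) n_gt0; have h0 : 0 <= modz (k - 1) n%:Z by rewrite modz_ge0; lia.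
have hr : (absz (modz (k - 1) n%:Z) < n)%N by lia.
by exists (divz (k - 1) n%:Z), (Ordinal hr) => /=; rewrite gez0_abs // -divz_eq subrK.
Qed.

Lemma vtx_fdeg_ex (l : 'I_n) (d : int) : exists e k, vtx k = l /\ fdeg e k = d.
Proof.
have hd := divz_eq d 2; have h1 := ltz_pmod d (isT : 0 < (2 : int)).
have h0 : 0 <= modz d 2 by rewrite modz_ge0.
exists (modz d 2 == 1), ((- divz d 2) * n%:Z + l%:Z + 1).
by rewrite vtxE fdegE; split=> //; case: eqP => ? /=; lia.
Qed.

Lemma filP X e k v : is_cm X -> fil X e k v = (v <= Fil X e k)%MS.
Proof. exact: flP. Qed.

Lemma filteredP X Y (Phi : 'M[K]_(rk X o, rk Y o)) :
  filtered Phi <-> forall e k v, fil X e k v -> fil Y e k (v *m Phi).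
Proof.
split=> [h e k v|h l d v]; first exact: h.
by have [e [k [<- <-]]] := vtx_fdeg_ex l d; apply: h.
Qed.

(** Inside a turn this is the action of e_(i,i+1); between two turns it is that of x^2 e_(n,1),
    which accounts for the shift by 2 in [fdeg]. For n >= 3 these exponents are indeed 0 and 2. *)
Lemma fil_dec1 X e k v : is_cm X -> fil X e (k + 1) v -> fil X e k v.
Proof.
move=> hX; have [q [r ->]] := index_ex k; rewrite /fil !vtxE !fdegE.
have := ltn_ord r; case: (ltnP r.+1 n) => hr hr'.
  have -> : q * n%:Z + r%:Z + 1 + 1 = q * n%:Z + (Ordinal hr)%:Z + 1 by rewrite /=; lia.
  rewrite vtxE fdegE; apply: fl_step => //; rewrite /cc /=; do ?case: ifP => ?; lia.
have h0 : (0 < n)%N by lia.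
have -> : q * n%:Z + r%:Z + 1 + 1 = (q + 1) * n%:Z + (Ordinal h0)%:Z + 1.
  by rewrite /= mulrDl mul1r; have := ltn_ord r; lia.
rewrite vtxE fdegE; apply: fl_step => //; rewrite /cc /=.
by do ?case: ifP => ?; lia.
Qed.

Lemma fil_dec X e k k' v : is_cm X -> k <= k' -> fil X e k' v -> fil X e k v.
Proof.
move=> hX hk; have -> : k' = k + (absz (k' - k))%:Z by lia.
elim: (absz _) => [|m IH]; first by rewrite addr0.
by move=> h; apply: IH; apply: fil_dec1 => //; have -> : k + m%:Z + 1 = k + m.+1%:Z by lia.
Qed.

(** Action of x e_(i+1,i), or of x^-1 e_(1,n) when k is at vertex n. *)
Lemma fil_AB X k v : is_cm X -> fil X false k v -> fil X true (k + 1) v.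
Proof.
move=> hX; have [q [r ->]] := index_ex k; rewrite /fil !vtxE !fdegE.
have := ltn_ord r; case: (ltnP r.+1 n) => hr hr'.
  have -> : q * n%:Z + r%:Z + 1 + 1 = q * n%:Z + (Ordinal hr)%:Z + 1 by rewrite /=; lia.
  rewrite vtxE fdegE; apply: fl_step => //; rewrite /cc /=.
  by do ?case: ifP => ?; lia.
have h0 : (0 < n)%N by lia.
have -> : q * n%:Z + r%:Z + 1 + 1 = (q + 1) * n%:Z + (Ordinal h0)%:Z + 1.
  by rewrite /= mulrDl mul1r; have := ltn_ord r; lia.
rewrite vtxE fdegE; apply: fl_step => //; rewrite /cc /=.
by do ?case: ifP => ?; lia.
Qed.

(** The same two generators starting from an odd degree: the vertex advances by one but the even
    degree reached belongs to the previous turn, a net change of 1 - n in the index. *)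
Lemma fil_BA X k v : is_cm X -> fil X true (k + n%:Z - 1) v -> fil X false k v.
Proof.
move=> hX; have [j hj] : exists j, j = k + n%:Z - 1 by exists (k + n%:Z - 1).
rewrite -hj; have -> : k = j + 1 - n%:Z by lia.
have [q [r {j hj}->]] := index_ex j.
have := ltn_ord r; case: (ltnP r.+1 n) => hr hr'.
  have -> : q * n%:Z + r%:Z + 1 + 1 - n%:Z = (q - 1) * n%:Z + (Ordinal hr)%:Z + 1.
    by rewrite /= mulrBl mul1r; lia.
  rewrite /fil !vtxE !fdegE; apply: fl_step => //; rewrite /cc /=.
  by do ?case: ifP => ?; lia.
have h0 : (0 < n)%N by lia.
have -> : q * n%:Z + r%:Z + 1 + 1 - n%:Z = q * n%:Z + (Ordinal h0)%:Z + 1.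
  by rewrite /=; have := ltn_ord r; lia.
rewrite /fil !vtxE !fdegE; apply: fl_step => //; rewrite /cc /=.
by do ?case: ifP => ?; lia.
Qed.

Lemma fil_exh X : is_cm X -> exists N, forall e k v, k <= N -> fil X e k v.
Proof.
move=> hX; have [D hD] := fl_exhaust o X.
pose k0 := (- (absz D)%:Z) * n%:Z + o%:Z + 1; exists k0 => e k v hk.
have h0 : fil X false k0 v.
  rewrite /fil vtxE fdegE; apply: fl_step (hD v) => //.
  by rewrite /cc; do ?case: ifP => ?; lia.
apply: fil_dec hk _ => //; case: e => //.
by apply: fil_dec (fil_AB hX h0) => //; lia.
Qed.

Lemma fil_sep X : is_cm X -> exists N, forall e k v, N <= k -> fil X e k v -> v = 0.
Proof.
move=> hX.
pose m := \big[Order.min/0]_q @gdeg K n X o q.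
have hm q : m <= @gdeg K n X o q by exact: bigmin_le_cond.
have base : forall d v, d < m -> fl o X o d v -> v = 0.
  move=> d v hd /suppP hv.
  rewrite -[v]mulmx1 -(fromOK o o hX) mulmxA.
  suff -> : v *m fromO o X o = 0 by rewrite mul0mx.
  apply/rowP=> q; rewrite [RHS]mxE; apply/eqP/negPn/negP => /hv hq.
  by have := hm q; lia.
(* The margin n pays for passing from the odd to the even filtration, which costs n - 1. *)
pose k0 := ((absz m)%:Z + 1) * n%:Z + o%:Z + 1; exists (k0 + n%:Z) => e k v hk hv.
have hA : fil X false k0 v.
  case: e hv => hv; last by apply: fil_dec hv => //; lia.
  by apply: fil_BA => //; apply: fil_dec hv => //; lia.
by move: hA; rewrite /fil vtxE fdegE; apply: base; lia.
Qed.

Lemma fil0 X e k : is_cm X -> fil X e k 0.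
Proof. by move=> hX; rewrite filP // sub0mx. Qed.

Lemma filD X e k u v : is_cm X -> fil X e k u -> fil X e k v -> fil X e k (u + v).
Proof. by move=> hX; rewrite !filP //; apply: addmx_sub. Qed.

Lemma filZ X e k (c : K) u : is_cm X -> fil X e k u -> fil X e k (c *: u).
Proof. by move=> hX; rewrite !filP //; apply: scalemx_sub. Qed.

Lemma filB X e k u v : is_cm X -> fil X e k u -> fil X e k v -> fil X e k (u - v).
Proof. by move=> hX hu hv; apply: filD => //; rewrite -scaleN1r; apply: filZ. Qed.

Lemma filZE X e k (c : K) u : is_cm X -> c != 0 -> fil X e k (c *: u) -> fil X e k u.
Proof. by move=> hX hc /(filZ c^-1 hX); rewrite scalerA mulVf // scale1r. Qed.

End Filtrations.

Arguments fil {K n} o X e k v.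

(** * The modules (a,b) as filtered lines *)

Section RankOne.
Variables (K : fieldType) (n : nat) (o : 'I_n).
Hypothesis hn : (3 <= n)%N.
Implicit Types (X Y Z : gmod K n) (e : bool) (k a b : int).

Definition jbase a b : 'I_n -> int :=
  let q := divz (a - 1) n%:Z in
  let i := a - q * n%:Z in
  if b - q * n%:Z <= n%:Z then @base_deg n i (b - q * n%:Z)
  else @base_deg n (b - (q + 1) * n%:Z) i.

Definition jshift a b : int :=
  let q := divz (a - 1) n%:Z in if b - q * n%:Z <= n%:Z then 2 * q else 2 * q + 1.

(* [mod_ab] with the case distinction pushed into the degrees, so that the
   ranks compute to 1. *)
Definition jmod a b : gmod K n := shiftg (lat K (jbase a b)) (jshift a b).

Lemma mod_abE a b : mod_ab K n a b = jmod a b.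
Proof. by rewrite /mod_ab /jmod /jbase /jshift; case: ifP. Qed.

Definition valid a b : bool := 0 < b - a < n%:Z.

Lemma jbase_ex a b : valid a b -> exists i j : int,
  [/\ 1 <= i, i < j, j <= n%:Z & jbase a b = @base_deg n i j].
Proof.
move=> /andP[h1 h2]; have hm := ltz_pmod (a - 1) (n_gt0 hn).
have h0 : 0 <= modz (a - 1) n%:Z by rewrite modz_ge0; lia.
have hd := divz_eq (a - 1) n%:Z; rewrite /jbase; set q := divz _ _ in hd *.
case: ifP => hb; first by exists (a - q * n%:Z), (b - q * n%:Z); split=> //; lia.
by exists (b - (q + 1) * n%:Z), (a - q * n%:Z); rewrite mulrDl mul1r; split=> //; lia.
Qed.

Lemma base_cc (i j : int) (k l : 'I_n) : 1 <= i -> i < j -> j <= n%:Z ->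
  0 <= cc k l + @base_deg n i j l - @base_deg n i j k.
Proof.
move=> h1 h2 h3; have hk := ltn_ord k; have hl := ltn_ord l.
by rewrite /cc /base_deg; do !case: ifP => ?; lia.
Qed.

Lemma cc_triangle (j k l : 'I_n) : cc j l <= cc j k + cc k l.
Proof.
have hj := ltn_ord j; have hk := ltn_ord k; have hl := ltn_ord l.
by rewrite /cc; do !case: ifP => ?; lia.
Qed.

Lemma cc_diag (k : 'I_n) : cc k k = 0.
Proof. by have hk := ltn_ord k; rewrite /cc leqnn; case: ifP => //; lia. Qed.

Lemma jmod_cm a b : valid a b -> is_cm (jmod a b).
Proof.
move=> /jbase_ex [i [j [h1 h2 h3 hb]]].
have hc (k l : 'I_n) : 0 <= cc k l + jbase a b l - jbase a b k by rewrite hb; exact: base_cc.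
split=> [k l p q|k|j' k l].
- rewrite mxE => m; rewrite coefXn; set d := absz _; have [-> _|_] := eqVneq m d; last by rewrite eqxx.
  by rewrite /d /= gez0_abs //; ring.
- apply/matrixP=> p q; rewrite !mxE !ord1 eqxx cc_diag.
  by rewrite add0r subrr expr0.
- apply/matrixP=> p q; rewrite !mxE big_ord1 !mxE -!exprD; congr (_ ^+ _).
  by have := hc k l; have := hc j' k; have := hc j' l; have := cc_triangle j' k l; rewrite /ee; lia.
Qed.

Lemma jmod_deg a b e k : valid a b ->
  (jbase a b (vtx o k) - jshift a b <= fdeg n e k) = (k <= if e then b else a).
Proof.
move=> /andP[hab1 hab2]; have [p [r ->]] := index_ex hn k.
rewrite vtxE // fdegE //.
have hm := ltz_pmod (a - 1) (n_gt0 hn).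
have h0 : 0 <= modz (a - 1) n%:Z by rewrite modz_ge0; lia.
have hd := divz_eq (a - 1) n%:Z; rewrite /jbase /jshift; set q := divz _ _ in hd *.
have hr := ltn_ord r.
(* In turns of length n, a lies in turn q and b in turn q or q + 1; for any other turn p the answer
   does not depend on the vertex. *)
have [hp|[hp|[hp|hp]]] : p <= q - 1 \/ p = q \/ p = q + 1 \/ q + 2 <= p by lia.
- have hpn : p * n%:Z <= (q - 1) * n%:Z by rewrite ler_pM2r ?n_gt0.
  rewrite mulrBl mul1r in hpn.
  have -> : (p * n%:Z + r%:Z + 1 <= if e then b else a) = true by case: e; lia.
  by rewrite /base_deg; case: (e) => /=; do !case: ifP => ?; lia.
- subst p; case: e => /=; case: ifP => hb; rewrite /base_deg ?mulrDl ?mul1r;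
  by do !case: ifP => ?; lia.
- subst p; case: e => /=; case: ifP => hb; rewrite /base_deg ?mulrDl ?mul1r;
  by do !case: ifP => ?; lia.
- have hpn : (q + 2) * n%:Z <= p * n%:Z by rewrite ler_pM2r ?n_gt0.
  rewrite mulrDl in hpn.
  have -> : (p * n%:Z + r%:Z + 1 <= if e then b else a) = false by case: e; lia.
  by rewrite /base_deg; case: (e) => /=; do !case: ifP => ?; lia.
Qed.

Lemma fil_jmod a b e k (v : 'rV[K]_1) : valid a b ->
  fil o (jmod a b) e k v = (v == 0) || (k <= if e then b else a).
Proof.
move=> hab; rewrite -(jmod_deg _ _ hab) /fil /fl.
have -> : fromO o (jmod a b) (vtx o k) = 1%:M.
  apply/matrixP=> p q; rewrite !mxE /horner_eval hornerXn expr1n.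
  by rewrite (ord1 p) (ord1 q) eqxx.
rewrite mulmx1; have [->|hv] /= := eqVneq v 0.
  by apply/suppP=> q; rewrite mxE eqxx.
apply/suppP/idP => [h|h q _] //; apply: (h 0).
by apply: contraNneq hv => h0; apply/eqP/rowP=> q; rewrite ord1 h0 mxE.
Qed.

Lemma from_jmod a b X (v : 'rV[K]_(rk X o)) : valid a b -> is_cm X ->
  filtered (X := jmod a b) v <-> fil o X false a v /\ fil o X true b v.
Proof.
move=> hab hX; rewrite filteredP //; split=> [h|[hA hB] e k c].
  split; rewrite -[v]mul1mx; apply: (h _ _ (1%:M)); rewrite fil_jmod //= lexx orbT //.
rewrite fil_jmod // => /orP[/eqP->|hk]; first by rewrite mul0mx fil0.
rewrite [c]mx11_scalar mul_scalar_mx; apply: filZ => //.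
by case: e hk => hk; apply: fil_dec hk _.
Qed.

Lemma to_jmod a b X (phi : 'cV[K]_(rk X o)) : valid a b -> is_cm X ->
  filtered (Y := jmod a b) phi <->
  (forall v, fil o X false (a + 1) v -> v *m phi = 0) /\
  (forall v, fil o X true (b + 1) v -> v *m phi = 0).
Proof.
move=> hab hX; rewrite filteredP //; split=> [h|[hA hB] e k v hv].
  by split=> v /h; rewrite fil_jmod //= => /orP[/eqP //|]; lia.
rewrite fil_jmod //; case: leP => hk; first by rewrite orbT.
rewrite orbF; apply/eqP; case: e hv hk => hv hk; [apply: hB | apply: hA];
  by apply: fil_dec hv => //; lia.
Qed.

End RankOne.

Arguments jmod_cm {K n} hn {a b}.

(** * Linear algebra: prescribing functionals *)

Section LinearAlgebra.
Variable K : fieldType.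

(** Values prescribed on the rows of [M] extend to a linear map as soon as they respect every linear
    relation between these rows. *)
Lemma solve_mulmx m r s (M : 'M[K]_(m, r)) (N : 'M[K]_(m, s)) :
  (forall u : 'rV_m, u *m M = 0 -> u *m N = 0) -> exists psi, M *m psi = N.
Proof.
move=> h; exists (pinvmx M *m N); apply/eqP; rewrite mulmxA -subr_eq0 -{2}[N]mul1mx -mulmxBl.
apply/eqP/row_matrixP=> i; rewrite row_mul row0; apply: h.
by rewrite -row_mul mulmxBl mul1mx mulmxKpV // subrr row0.
Qed.

Lemma separating_functional m r (v : 'rV[K]_r) (F : 'M[K]_(m, r)) :
  ~~ (v <= F)%MS -> exists phi : 'cV_r, v *m phi = 1%:M /\ F *m phi = 0.
Proof.
move=> hv; have [|phi] := @solve_mulmx _ _ _ (col_mx v F) (col_mx (1%:M : 'M_1) 0).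
  move=> u; rewrite -[u]hsubmxK !mul_row_col mulmx1 mulmx0 addr0.
  set c := lsubmx u; set w := rsubmx u => h.
  (* A relation c v + w F = 0 with c nonzero would put v in the row space of F. *)
  apply: contraNeq hv => hc; rewrite [c]mx11_scalar in h hc.
  have hc0 : c 0 0 != 0 by apply: contraNneq hc => ->; rewrite raddf0.
  apply/submxP; exists (- (c 0 0)^-1 *: w).
  rewrite -scalemxAl -(_ : - (c 0 0 *: v) = w *m F).
    by rewrite scaleNr scalerN opprK scalerA mulVf // scale1r.
  by apply/eqP; rewrite eq_sym -subr_eq0 opprK -mul_scalar_mx addrC h.
rewrite mul_col_mx => /eq_col_mx[h1 h2]; by exists phi.
Qed.

Lemma cV_rV0 m r (u : 'cV[K]_m) (v : 'rV[K]_r) : u *m v = 0 -> u = 0 \/ v = 0.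
Proof.
have [->|hu] := eqVneq u 0; [by left | move=> h; right].
have [i hi] : exists i, u i 0 != 0.
  apply/existsP; apply: contraNT hu => /existsPn hu; apply/eqP/colP=> i.
  by rewrite mxE; apply/eqP; have := hu i; rewrite negbK.
apply/rowP=> j; have /matrixP/(_ i j) := h; rewrite !mxE big_ord1 => /eqP.
by rewrite mulf_eq0 (negPf hi) => /eqP.
Qed.

Lemma mx1_neq0 m : (0 < m)%N -> (1%:M : 'M[K]_m) != 0.
Proof. by move=> hm; rewrite -mxrank_eq0 mxrank1 -lt0n. Qed.

End LinearAlgebra.

(** * Morphisms from and to (a,b), and their splitting *)

Section Homs.
Variables (K : fieldType) (n : nat) (o : 'I_n).
Hypothesis hn : (3 <= n)%N.
Implicit Types (X Y Z : gmod K n) (e : bool) (k a b : int).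

Notation jmod := (@jmod K n).

Lemma hom_ex X Y (Phi : 'M[K]_(rk X o, rk Y o)) : is_cm X -> is_cm Y -> filtered Phi ->
  exists F : ghom X Y, is_hom F /\ fib o F = Phi.
Proof.
move=> hX hY hPhi; exists (lift_hom Phi).
by split; [apply: lift_homP | apply: fib_lift].
Qed.

Lemma hom_from a b X (v : 'rV[K]_(rk X o)) : valid n a b -> is_cm X ->
  fil o X false a v -> fil o X true b v ->
  exists F : ghom (jmod a b) X, is_hom F /\ fib o F = v.
Proof.
move=> hab hX hA hB; apply: hom_ex => //; first exact: jmod_cm.
by apply/from_jmod.
Qed.

Lemma hom_fromP a b X (F : ghom (jmod a b) X) : valid n a b -> is_cm X -> is_hom F ->
  fil o X false a (fib o F) /\ fil o X true b (fib o F).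
Proof.
move=> hab hX hF; apply/(from_jmod hn (a := a) (b := b)) => //.
by apply: fib_filtered => //; exact: jmod_cm.
Qed.

Lemma hom_to a b X (phi : 'cV[K]_(rk X o)) : valid n a b -> is_cm X ->
  (forall v, fil o X false (a + 1) v -> v *m phi = 0) ->
  (forall v, fil o X true (b + 1) v -> v *m phi = 0) ->
  exists F : ghom X (jmod a b), is_hom F /\ fib o F = phi.
Proof.
move=> hab hX hA hB; apply: hom_ex => //; first exact: jmod_cm.
by apply/to_jmod.
Qed.

Lemma hom_toP a b X (F : ghom X (jmod a b)) : valid n a b -> is_cm X -> is_hom F ->
  (forall v, fil o X false (a + 1) v -> v *m fib o F = 0) /\
  (forall v, fil o X true (b + 1) v -> v *m fib o F = 0).
Proof.
move=> hab hX hF; apply/(to_jmod hn (a := a) (b := b)) => //.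
by apply: fib_filtered => //; exact: jmod_cm.
Qed.

Lemma fil_hom X Y (F : ghom X Y) e k v : is_cm X -> is_cm Y -> is_hom F ->
  fil o X e k v -> fil o Y e k (v *m fib o F).
Proof. by move=> hX hY hF; apply: fib_filtered. Qed.

Lemma hom_jmod0 a b c d (F : ghom (jmod a b) (jmod c d)) : valid n a b -> valid n c d ->
  is_hom F -> ~~ ((a <= c) && (b <= d)) -> fib o F = 0.
Proof.
move=> hab hcd hF; have [] := hom_fromP hab (jmod_cm hn hcd) hF.
rewrite !fil_jmod // => /orP[/eqP //|h1] /orP[/eqP //|h2].
by move: h1 h2 => /= -> ->.
Qed.

Lemma jhom_ex a b c d : valid n a b -> valid n c d -> a <= c -> b <= d ->
  exists F : ghom (jmod a b) (jmod c d), is_hom F /\ fib o F = 1%:M.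
Proof.
move=> hab hcd hac hbd.
apply: (@hom_from a b (jmod c d) 1%:M) => //; rewrite ?fil_jmod //= ?hac ?hbd ?orbT //.
exact: jmod_cm.
Qed.

Lemma jmod_iso_inj a b c d : valid n a b -> valid n c d ->
  iso (jmod a b) (jmod c d) -> a = c /\ b = d.
Proof.
move=> hab hcd [F [G [hF hG hFG hGF]]].
have h1 : fib o F *m fib o G = 1%:M by rewrite -fib_comp hFG fib_id.
have nz : (1%:M : 'M[K]_1) != 0 by apply: mx1_neq0.
have hac : (a <= c) && (b <= d).
  by apply: contraNT nz => /(hom_jmod0 hab hcd hF) h; move: h1; rewrite h mul0mx => /esym/eqP.
have hca : (c <= a) && (d <= b).
  by apply: contraNT nz => /(hom_jmod0 hcd hab hG) h; move: h1; rewrite h mulmx0 => /esym/eqP.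
by move/andP: hac => [? ?]; move/andP: hca => [? ?]; split; apply/le_anti/andP.
Qed.

Lemma fib_split X Y (F : ghom X Y) (G : ghom Y X) : is_cm X -> is_cm Y ->
  is_hom F -> is_hom G -> fib o F *m fib o G = 1%:M -> comp F G = idh X.
Proof.
move=> hX hY hF hG h; apply: (@fib_inj K n o) => //; first exact: comp_hom.
  exact: idh_hom.
by rewrite fib_comp fib_id.
Qed.

Lemma nonsplit_mono_from a b X (F : ghom (jmod a b) X) : valid n a b -> is_cm X ->
  is_hom F -> ~ split_mono F ->
  exists p q, [/\ fib o F = p + q, fil o X false (a + 1) p & fil o X true (b + 1) q].
Proof.
move=> hab hX hF hns; set v : 'rV_(rk X o) := fib o F.
have hv : (v <= Fil o X false (a + 1) + Fil o X true (b + 1))%MS.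
  apply/negPn/negP => /separating_functional [phi [h1 h2]]; apply: hns.
  have h3 w : (w <= Fil o X false (a + 1) + Fil o X true (b + 1))%MS -> w *m phi = 0.
    by case/submxP=> y ->; rewrite -mulmxA h2 mulmx0.
  have [G [hG hphi]] : exists G : ghom X (jmod a b), is_hom G /\ fib o G = phi.
    apply: hom_to => // w; rewrite filP // => hw; apply: h3.
      exact: submx_trans hw (addsmxSl _ _).
    exact: submx_trans hw (addsmxSr _ _).
  exists G; split=> //; apply: fib_split => //; first exact: jmod_cm.
  by rewrite hphi.
have /sub_addsmxP[[y z] /= ->] := hv.
by exists (y *m Fil o X false (a + 1)), (z *m Fil o X true (b + 1)); rewrite !filP // !submxMl.
Qed.

Lemma nonsplit_epi_to a b X (F : ghom X (jmod a b)) v : valid n a b -> is_cm X ->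
  is_hom F -> ~ split_epi F -> fil o X false a v -> fil o X true b v -> v *m fib o F = 0.
Proof.
move=> hab hX hF hns hA hB; apply/eqP/negPn/negP => h.
set c : 'M[K]_1 := v *m fib o F in h.
have hc0 : c 0 0 != 0 by apply: contraNneq h => h0; rewrite [c]mx11_scalar h0 raddf0.
have [G [hG hv]] : exists G : ghom (jmod a b) X, is_hom G /\ fib o G = (c 0 0)^-1 *: v.
  by apply: hom_from => //; apply: filZ.
apply: hns; exists G; split=> //; apply: fib_split => //; first exact: jmod_cm.
rewrite hv -scalemxAl (_ : v *m _ = (c 0 0)%:M); last exact: mx11_scalar.
by rewrite scale_scalar_mx mulVf.
Qed.

Lemma rad_nonsplit_mono X Y (F : ghom X Y) : (0 < rk X o)%N -> in_rad F -> ~ split_mono F.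
Proof.
move=> hX [hF hrad] [G [hG hFG]]; have [u [hu h _]] := hrad G hG.
have /eqP := congr1 (fib o) h; apply/negP.
by rewrite fib_comp fib_sub hFG subrr mul0mx fib_id eq_sym mx1_neq0.
Qed.

Lemma rad_nonsplit_epi X Y (F : ghom X Y) : (0 < rk Y o)%N -> in_rad F -> ~ split_epi F.
Proof.
move=> hY [hF hrad] [G [hG hGF]]; have [u [hu h _]] := hrad G hG.
have h1 : fib o G *m fib o F = 1%:M by rewrite -fib_comp hGF fib_id.
have h2 := congr1 (fib o) h; rewrite fib_comp fib_sub fib_comp !fib_id in h2.
(* [in_rad] tests invertibility at the source only; but G F = 1 gives G (1 - F G) = 0, and 1 - F G
   is invertible. *)
have h3 : fib o G = 0.
  rewrite -[LHS]mulmx1 -h2 mulmxA mulmxBr mulmx1 mulmxA h1 mul1mx subrr mul0mx //.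
by have /negP[] := mx1_neq0 K hY; rewrite -h1 h3 mul0mx.
Qed.

End Homs.

(** * A basis for the complement of a split line *)

Section SplitOff.
Variables (R : comNzRingType) (m : nat) (q : 'I_m) (c : R).
Variables (i : 'rV[R]_m) (p : 'cV[R]_m).
Hypotheses (hip : i *m p = 1%:M) (hc : c * i 0 q = 1).

Let D : 'cV[R]_m := c *: delta_mx q 0.

(* When coordinate [q] of [i] is invertible, the basis vectors other than [q],
   projected along [i], form a basis of the kernel of [p]. *)
Definition ker_in : 'M[R]_(m.-1, m) := row' q 1%:M *m (1%:M - p *m i).
(** Subtracts from a row the multiple of [i] that clears coordinate [q], then drops that
    coordinate. *)
Definition ker_out : 'M[R]_(m, m.-1) := (1%:M - D *m i) *m col' q 1%:M.

Lemma iD : i *m D = 1%:M.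
Proof.
rewrite /D -scalemxAr; apply/matrixP=> s t; rewrite !ord1 !mxE eqxx -[RHS]hc; congr (_ * _).
by rewrite (bigD1 q) //= big1 ?addr0 ?mxE ?eqxx ?mulr1 // => u hu; rewrite mxE (negPf hu) mulr0.
Qed.

Lemma row'_col' : (row' q 1%:M : 'M[R]_(m.-1, m)) *m (col' q 1%:M) = 1%:M.
Proof.
apply/matrixP=> s t; rewrite !mxE (bigD1 (lift q s)) //= big1 => [|u hu].
  by rewrite !mxE eqxx mul1r addr0 (inj_eq lift_inj).
by rewrite !mxE eq_sym (negPf hu) mul0r.
Qed.

Lemma col'_row' : (col' q 1%:M : 'M[R]_(m, m.-1)) *m (row' q 1%:M) = 1%:M - delta_mx q q.
Proof.
apply/matrixP=> s t; rewrite !mxE; case: (unliftP q s) => [u ->|->].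
  rewrite (bigD1 u) //= big1 => [|v hv].
    by rewrite !mxE eqxx mul1r addr0 eq_sym [lift q u == q]eq_sym (negPf (neq_lift q u)) subr0 eq_sym.
  by rewrite !mxE (inj_eq lift_inj) eq_sym (negPf hv) mul0r.
rewrite eqxx /= [t == q]eq_sym subrr big1 // => v _.
by rewrite !mxE (negPf (neq_lift q v)) mul0r.
Qed.

Lemma row'_D : (row' q 1%:M : 'M[R]_(m.-1, m)) *m D = 0.
Proof.
apply/matrixP=> s t; rewrite !mxE big1 // => u _; rewrite !mxE.
case: (eqVneq u q) => [->|]; last by rewrite !mulr0.
by rewrite eq_sym (negPf (neq_lift q s)) mul0r.
Qed.

Lemma ker_in_p : ker_in *m p = 0.
Proof. by rewrite /ker_in -mulmxA mulmxBl mul1mx -mulmxA hip mulmx1 subrr mulmx0. Qed.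

Lemma ker_i_out : i *m ker_out = 0.
Proof. by rewrite /ker_out mulmxA mulmxBr mulmx1 mulmxA iD mul1mx subrr mul0mx. Qed.

(** Both [1%:M - p *m i] and [1%:M - D *m i] kill the row [i], so a product of the two equals its
    right factor. *)
Lemma ker_in_out : ker_in *m ker_out = 1%:M.
Proof.
have h : (1%:M - p *m i) *m (1%:M - D *m i) = 1%:M - D *m i.
  rewrite mulmxBl mul1mx -mulmxA mulmxBr mulmx1 mulmxA iD mul1mx.
  by rewrite subrr mulmx0 subr0.
rewrite /ker_in /ker_out -mulmxA [(_ - _) *m _]mulmxA h mulmxA mulmxBr mulmx1.
by rewrite mulmxA row'_D mul0mx subr0 row'_col'.
Qed.

Lemma ker_out_in : ker_out *m ker_in = 1%:M - p *m i.
Proof.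
rewrite /ker_out /ker_in mulmxA -[_ *m col' _ _ *m _]mulmxA col'_row'.
have h : (1%:M - D *m i) *m delta_mx q q = 0.
  have -> : delta_mx q q = D *m (i 0 q *: delta_mx 0 q).
    rewrite /D -scalemxAl -scalemxAr scalerA hc scale1r.
    by rewrite mul_delta_mx.
  by rewrite mulmxA mulmxBl mul1mx -mulmxA iD mulmx1 subrr mul0mx.
have hi : (1%:M - D *m i) *m (1%:M - p *m i) = 1%:M - p *m i.
  rewrite mulmxBl mul1mx -mulmxA mulmxBr mulmx1 mulmxA hip mul1mx.
  by rewrite subrr mulmx0 subr0.
by rewrite [_ *m (1%:M - delta_mx _ _)]mulmxBr mulmx1 h subr0 hi.
Qed.

End SplitOff.

(** * Graded complements of split submodules (a,b) *)

Section Complement.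
Variables (K : fieldType) (n : nat) (o : 'I_n).
Hypothesis hn : (3 <= n)%N.
Implicit Types (X Y Z : gmod K n) (a b : int).

Notation jmod := (@jmod K n).

(** Since i p = 1, some coordinate contributes a nonzero term at x = 1. Its entry in [i] bounds the
    degree of that basis vector from above and its entry in [p] from below, so the degree equals
    that of the generator and the entry of [i] is constant. *)
Lemma pivot_ex (a b : int) X (i : ghom (jmod a b) X) (p : ghom X (jmod a b)) (k : 'I_n) :
  is_hom i -> is_hom p -> comp i p = idh (jmod a b) ->
  exists q : 'I_(rk X k), exists c : K,
    [/\ @gdeg K n X k q = jbase a b k - jshift n a b, i k 0 q = c%:P & c != 0].
Proof.
move=> hi hp hip; have hipk : i k *m p k = 1%:M by rewrite -[LHS]/(comp i p k) hip.
have [q hq] : exists q, (i k 0 q).[1] * (p k q 0).[1] != 0.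
  apply/existsP; apply: contraT => /existsPn h.
  have /matrixP/(_ 0 0)/(congr1 (horner^~ 1)) := hipk.
  rewrite !mxE eqxx hornerC horner_sum big1 => [/esym/eqP|q _]; first by rewrite oner_eq0.
  by rewrite hornerM; apply/eqP; have := h q; rewrite negbK.
have [h1 h2] : (i k 0 q).[1] != 0 /\ (p k q 0).[1] != 0.
  by move: hq; rewrite mulf_eq0 negb_or => /andP.
have d1 := homog_neg (hmx_hom k hi 0 q) h1; have d2 := homog_neg (hmx_hom k hp q 0) h2.
have e1 := homogE (hmx_hom k hi 0 q).
exists q, (i k 0 q).[1]; split=> //; first by move: d1 d2 => /=; lia.
rewrite e1 d1 (_ : absz _ = 0%N); last by move: d1 d2 => /=; lia.
by rewrite expr0 hornerZ hornerC mulr1 alg_polyC.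
Qed.

Lemma hmx1 m (d : 'I_m -> int) : hmx d d (1%:M : 'M[{poly K}]_m).
Proof.
move=> s t; rewrite mxE; case: eqP => [->|_]; last exact: homog0.
by move=> [|u]; rewrite subrr coef1 ?eqxx.
Qed.

Lemma hmxB m r (a : 'I_m -> int) (b : 'I_r -> int) (A B : 'M[{poly K}]_(m, r)) :
  hmx a b A -> hmx a b B -> hmx a b (A - B).
Proof.
move=> hA hB s t; rewrite !mxE; apply: homogD => // u.
by rewrite coefN oppr_eq0; apply: hB.
Qed.

Lemma complement_ex (a b : int) X (i : ghom (jmod a b) X) (p : ghom X (jmod a b)) :
  is_cm X -> is_hom i -> is_hom p -> comp i p = idh (jmod a b) ->
  exists Y, is_cm Y /\ is_biprod X (jmod a b) Y.
Proof.
move=> hX hi hp hip.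
have hipk k : i k *m p k = 1%:M by rewrite -[LHS]/(comp i p k) hip.
have /fin_all_exists[q /fin_all_exists[c hqc]] := fun k => pivot_ex k hi hp hip.
have hc k : (c k)^-1%:P * i k 0 (q k) = 1.
  by have [_ -> hc0] := hqc k; rewrite -polyCM mulVf.
pose j k := ker_in (q k) (i k) (p k).
pose r k := ker_out (q k) (c k)^-1%:P (i k).
(* The projection [1%:M - p k *m i k] preserves degrees, so the remaining basis vectors keep
   theirs. *)
pose dY k (s : 'I_(rk X k).-1) := @gdeg K n X k (lift (q k) s).
have hjX k : hmx (dY k) (@gdeg K n X k) (j k).
  apply: (@hmxM _ _ _ _ _ (@gdeg K n X k)).
    by move=> s t; rewrite mxE; apply: hmx1.
  by apply: hmxB (hmx1 _) _; apply: hmxM (hmx_hom k hp) (hmx_hom k hi).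
have hrX k : hmx (@gdeg K n X k) (dY k) (r k).
  apply: (@hmxM _ _ _ _ _ (@gdeg K n X k)); last first.
    by move=> s t; rewrite mxE; apply: hmx1.
  apply: hmxB (hmx1 _) _.
  apply: (hmxM (b := fun _ => jbase a b k - jshift n a b)) _ (hmx_hom k hi).
  move=> s t; rewrite !mxE.
  case: (eqVneq s (q k)) => [->|_] /=; last by rewrite mulr0; exact: homog0.
  have [-> _ _] := hqc k; rewrite (ord1 t) eqxx mulr1 subrr => -[|u] //.
  by rewrite coefC eqxx.
have jr k : j k *m r k = 1%:M by exact: (ker_in_out (p k) (hc k)).
have rj k : r k *m j k = 1%:M - p k *m i k by exact: (ker_out_in (hipk k) (hc k)).
have jp k : j k *m p k = 0 by exact: (ker_in_p (q k) (hipk k)).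
have ir k : i k *m r k = 0 by exact: ker_i_out (hc k).
clearbody j r.
pose Y := @GMod K n (fun k => (rk X k).-1) dY (fun k l => j l *m act X k l *m r k).
have hj : is_hom (j : ghom Y X).
  split=> [l s t|k l]; first exact: (hjX l).
  change (j l *m act X k l *m r k *m j k = j l *m act X k l).
  rewrite -mulmxA rj mulmxBr mulmx1 mulmxA -[_ *m p k]mulmxA (proj2 hp) mulmxA jp.
  by rewrite !mul0mx subr0.
have hr : is_hom (r : ghom X Y).
  split=> [l s t|k l]; first exact: (hrX l).
  change (act X k l *m r k = r l *m (j l *m act X k l *m r k)).
  rewrite !mulmxA rj !mulmxBl mul1mx -[_ *m i l *m _]mulmxA -(proj2 hi).
  by rewrite -!mulmxA ir !mulmx0 subr0.
have hY : is_cm Y.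
  split=> [k l|k|k1 k2 l].
  - have hs := hmxM (hmx_shift (cc k l) (hjX l)) (hmx_act k l hX).
    exact: hmxM hs (hrX k).
  - change (j k *m act X k k *m r k = 1%:M).
    by rewrite (let: And3 _ h _ := hX in h k) mulmx1 jr.
  change (act Y k2 l *m (j k2 *m act X k1 k2 *m r k1) = 'X^(ee k1 k2 l) *: (j l *m act X k1 l *m r k1)).
  rewrite !mulmxA (proj2 hj) -[j l *m _ *m act X k1 k2]mulmxA (let: And3 _ _ h := hX in h k1 k2 l).
  by rewrite -scalemxAr -scalemxAl.
exists Y; split=> //; exists i, j, p, r; split=> //.
- exact: functional_extensionality_dep.
- by split; apply: functional_extensionality_dep.
apply: functional_extensionality_dep => k.
by rewrite /addh /comp rj addrC subrK.
Qed.

End Complement.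

(** * Classification of the indecomposables *)

Section Classification.
Variables (K : fieldType) (n : nat) (o : 'I_n).
Hypothesis hn : (3 <= n)%N.
Implicit Types (X Y Z : gmod K n) (a b : int).

Notation jmod := (@jmod K n).

Lemma int_last (P : int -> bool) (N M : int) :
  P N -> (forall k, M <= k -> ~~ P k) -> exists a, [/\ N <= a, P a & ~~ P (a + 1)].
Proof.
have [m hm] : exists m, m = absz (M - N) by exists (absz (M - N)).
elim: m N hm => [|m IH] N hm hN hM.
  have [hlt|hle] := ltP N M; first by lia.
  by have := hM N hle; rewrite hN.
have [h1|h1] := boolP (P (N + 1)); last by exists N.
have [hle|hlt] := leP M N; first by have := hM N hle; rewrite hN.
have [|a [ha1 ha2 ha3]] := IH (N + 1) _ h1 hM; first by lia.
by exists a; split=> //; lia.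
Qed.

Lemma rk_gt0 X : is_cm X -> ~ is_zero X -> (0 < rk X o)%N.
Proof.
move=> hX hz; rewrite lt0n; apply/eqP => h0; apply: hz => k.
by rewrite (rk_const k o hX).
Qed.

Lemma summand_ex X : is_cm X -> ~ is_zero X ->
  exists a b (F : ghom (jmod a b) X) (G : ghom X (jmod a b)),
    [/\ valid n a b, is_hom F, is_hom G & comp F G = idh (jmod a b)].
Proof.
move=> hX /(rk_gt0 hX) hr.
have hFil e k v : (v <= Fil o X e k)%MS = fil o X e k v by rewrite filP.
have [N hN] := fil_exh o hn hX; have [M hM] := fil_sep o hn hX.
have [a [_ ha ha1]] : exists a, [/\ N <= a, Fil o X false a != 0 & ~~ (Fil o X false (a + 1) != 0)].
  apply: (int_last (P := fun k => Fil o X false k != 0) (M := M)) => [|k hk].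
    apply/rowV0Pn; exists (delta_mx 0 (Ordinal hr)); first by rewrite hFil hN.
    apply/eqP => /matrixP/(_ 0 (Ordinal hr)); rewrite !mxE !eqxx => /eqP.
    by rewrite oner_eq0.
  by apply/negP => /rowV0Pn[v]; rewrite hFil => /hM -> //; rewrite eqxx.
have A0 v : fil o X false (a + 1) v -> v = 0.
  move=> hv; apply/eqP; apply: contraNT ha1 => hv0.
  by apply/rowV0Pn; exists v; rewrite ?hFil.
pose P k := (Fil o X false a :&: Fil o X true k)%MS != 0.
have hP k : reflect (exists v, [/\ fil o X false a v, fil o X true k v & v != 0]) (P k).
  apply: (iffP (@rowV0Pn _ _ _ (Fil o X false a :&: Fil o X true k)%MS)) => [[v]|[v [h1 h2 h3]]].
    by rewrite sub_capmx !hFil => /andP[h1 h2] h3; exists v.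
  by exists v; rewrite // sub_capmx !hFil h1 h2.
(* The search starts at a + 1 because A_a lies in B_(a+1), and stops before a + n because B_(a+n)
   lies in A_(a+1) = 0; these bounds make (a,b) valid. *)
have [b [hb1 /hP[v [vA vB v0]] hb3]] : exists b, [/\ a + 1 <= b, P b & ~~ P (b + 1)].
  apply: (int_last (M := a + n%:Z)) => [|k hk].
    have /rowV0Pn[v] := ha; rewrite hFil => vA v0; apply/hP; exists v; split=> //.
    exact: fil_AB.
  apply/negP => /hP[v [vA vB v0]]; move: v0; rewrite (A0 v) ?eqxx //.
  apply: fil_BA => //; apply: fil_dec vB => //; lia.
have hb2 : b < a + n%:Z.
  rewrite ltNge; apply/negP => hb2; move: v0; rewrite (A0 v) ?eqxx //.
  apply: fil_BA => //; apply: fil_dec vB => //; lia.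
have hab : valid n a b by rewrite /valid; lia.
have hv : ~~ (v <= Fil o X true (b + 1))%MS.
  by apply/negP; rewrite hFil => hv; have /hP[] := hb3; exists v.
have [phi [h1 h2]] := separating_functional hv.
have [F [hF fF]] := hom_from hn hab hX vA vB.
have [G [hG fG]] : exists G : ghom X (jmod a b), is_hom G /\ fib o G = phi.
  apply: hom_to => // [w /A0 ->|w]; first by rewrite mul0mx.
  by rewrite -hFil => /submxP[y ->]; rewrite -mulmxA h2 mulmx0.
exists a, b, F, G; split=> //; apply: (@fib_split K n o) => //; first exact: jmod_cm.
by rewrite fF fG.
Qed.

Lemma indec_iso_jmod X : indec X -> exists a b, valid n a b /\ iso X (jmod a b).
Proof.
move=> [hX hz hd]; have [a [b [F [G [hab hF hG hFG]]]]] := summand_ex hX hz.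
have hJ := jmod_cm (K := K) hn hab.
have [Y [hY hXY]] := complement_ex hn hX hF hG hFG.
exists a, b; split=> //.
have [hJ0|hY0] := hd _ _ hJ hY hXY; first by have := hJ0 o.
have [i1 [i2 [p1 [p2 [[h1 [h2 [h3 h4]]] e1 _ _ e]]]]] := hXY.
exists p1, i1; split=> //; rewrite -e.
apply: functional_extensionality_dep => k; rewrite /addh.
suff -> : comp p2 i2 k = 0 by rewrite addr0.
by apply/matrixP=> s t; rewrite !mxE big1 // => u; have := hY0 k; have := ltn_ord u; lia.
Qed.

Lemma jmod_indec a b : valid n a b -> indec (jmod a b).
Proof.
move=> hab; have hJ := jmod_cm (K := K) hn hab.
split=> // [/(_ o) //|Y1 Y2 hY1 hY2 [i1 [i2 [p1 [p2 [hh e1 e2 [e3 e4] e5]]]]]].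
have isz Y : is_cm Y -> rk Y o = 0%N -> is_zero Y.
  by move=> hY h0 k; rewrite (rk_const k o hY).
case: (posnP (rk Y1 o)) => [/(isz _ hY1)|hr1]; first by left.
case: (posnP (rk Y2 o)) => [/(isz _ hY2)|hr2]; first by right.
(* The fibre of (a,b) is a line, so this is a column times a row, which vanishes only if one factor
   does. *)
have h0 : (fib o i1 : 'cV_(rk Y1 o)) *m (fib o p2 : 'rV_(rk Y2 o)) = 0.
  by have := fib_comp o i1 p2; rewrite e3 fib_zero => /esym.
exfalso; case: (cV_rV0 h0) => h.
  have := mx1_neq0 K hr1; rewrite -(fib_id o Y1) -e1 fib_comp.
  by rewrite [fib o i1]h mul0mx eqxx.
have := mx1_neq0 K hr2; rewrite -(fib_id o Y2) -e2 fib_comp.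
by rewrite [fib o p2]h mulmx0 eqxx.
Qed.

End Classification.

(** * Projective and injective (a,b) *)

Section ProjectiveInjective.
Variables (K : fieldType) (n : nat) (o : 'I_n).
Hypothesis hn : (3 <= n)%N.
Implicit Types (X Y Z : gmod K n) (a b : int).

Notation jmod := (@jmod K n).

(** In the two extreme cases A_a is contained in B_b or conversely, so the intersection is a single
    filtration step, along which strictness lifts vectors. *)
Lemma jmod_projective a b : valid n a b -> b = a + 1 \/ b = a + n%:Z - 1 ->
  projectiveCM (jmod a b).
Proof.
move=> hab hb; have hJ := jmod_cm (K := K) hn hab; split=> // A B C f g hs h hh.
have [[hA [hB hC]] hf hg _] := hs.
have [wA wB] := hom_fromP o hn hab hC hh.
have [v [vA vB hv]] : exists v, [/\ fil o B false a v, fil o B true b v & v *m fib o g = fib o h].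
  case: hb => hb.
    have [v vA hv] := ses_surj hs wA; exists v; split=> //.
    by rewrite hb; apply: fil_AB.
  have [v vB hv] := ses_surj hs wB; exists v; split=> //.
  by apply: fil_BA => //; rewrite -hb.
have [h' [hh' fh']] := hom_from hn hab hB vA vB.
exists h'; split=> //; apply: (@fib_inj K n o) => //; first exact: comp_hom.
by rewrite fib_comp fh'.
Qed.

(** Dually, A_(a+1) + B_(b+1) is then a single filtration step. *)
Lemma jmod_injective a b : valid n a b -> b = a + 1 \/ b = a + n%:Z - 1 ->
  injectiveCM (jmod a b).
Proof.
move=> hab hb; have hJ := jmod_cm (K := K) hn hab; split=> // A B C f g hs h hh.
have [[hA [hB hC]] hf hg _] := hs.
have [wA wB] := hom_toP o hn hab hA hh.
have [e [k [hA0 hkA hkB]]] : exists e k,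
    [/\ forall v, fil o A e k v -> v *m fib o h = 0,
        forall v, fil o B false (a + 1) v -> fil o B e k v &
        forall v, fil o B true (b + 1) v -> fil o B e k v].
  case: hb => hb; [exists true, (b + 1) | exists false, (a + 1)]; split=> // v.
    by rewrite hb; apply: fil_AB.
  by move=> hv; apply: fil_BA => //; apply: fil_dec hv => //; lia.
(* [psi] is prescribed on the image of [f] and on the step to be killed. By strictness a vector in
   both comes from the same step of A, which [h] kills. *)
have [|psi] := @solve_mulmx _ _ _ _ (col_mx (fib o f) (Fil o B e k)) (col_mx (fib o h) 0).
  move=> u; rewrite -[u]hsubmxK !mul_row_col mulmx0 addr0.
  move=> /eqP; rewrite addr_eq0 => /eqP hu; apply: hA0.
  have hB1 : fil o B e k (lsubmx u *m fib o f).
    by rewrite filP // hu -mulNmx submxMl.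
  have [|u' hu' hu'f] := ses_ker hs hB1; first by rewrite -mulmxA (ses_comp0 o hs) mulmx0.
  suff -> : lsubmx u = u' by [].
  apply/eqP; rewrite -subr_eq0; apply/eqP; apply: (ses_inj hs).
  by rewrite mulmxBl hu'f subrr.
rewrite mul_col_mx => /eq_col_mx[h1 h2].
have psi0 v : fil o B e k v -> v *m psi = 0.
  by rewrite filP // => /submxP[y ->]; rewrite -mulmxA h2 mulmx0.
have [h' [hh' fh']] : exists h' : ghom B (jmod a b), is_hom h' /\ fib o h' = psi.
  by apply: hom_to => // v hv; apply: psi0; [apply: hkA | apply: hkB].
exists h'; split=> //; apply: (@fib_inj K n o) => //; first exact: comp_hom.
by rewrite fib_comp fh'.
Qed.

End ProjectiveInjective.

(** * Direct sums *)

Section DirectSum.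
Variables (K : fieldType) (n : nat) (X Y : gmod K n).

Definition sum_deg m r (a : 'I_m -> int) (b : 'I_r -> int) (s : 'I_(m + r)) : int :=
  match split s with inl u => a u | inr u => b u end.

Lemma sum_degl m r (a : 'I_m -> int) (b : 'I_r -> int) u : sum_deg a b (lshift r u) = a u.
Proof. by rewrite /sum_deg (unsplitK (inl _ u)). Qed.

Lemma sum_degr m r (a : 'I_m -> int) (b : 'I_r -> int) u : sum_deg a b (rshift m u) = b u.
Proof. by rewrite /sum_deg (unsplitK (inr _ u)). Qed.

Definition dsum : gmod K n :=
  @GMod K n (fun k => rk X k + rk Y k)%N
    (fun k => sum_deg (@gdeg K n X k) (@gdeg K n Y k))
    (fun k l => block_mx (act X k l) 0 0 (act Y k l)).

Hypotheses (hX : is_cm X) (hY : is_cm Y).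

Lemma dsum_cm : is_cm dsum.
Proof.
split=> [k l s t|k|j k l].
- rewrite /=; case: (split_ordP s) => u ->; case: (split_ordP t) => w ->;
  rewrite ?sum_degl ?sum_degr ?block_mxEul ?block_mxEur ?block_mxEdl ?block_mxEdr;
  try (by rewrite mxE; exact: homog0).
    exact: (hmx_act k l hX).
  exact: (hmx_act k l hY).
- have [_ h1 _] := hX; have [_ h2 _] := hY.
  by rewrite /= h1 h2 -scalar_mx_block.
have [_ _ h1] := hX; have [_ _ h2] := hY.
rewrite /= mulmx_block !mulmx0 !mul0mx !addr0 !add0r h1 h2.
by rewrite scale_block_mx !scaler0.
Qed.

Lemma dsum_biprod : is_biprod dsum X Y.
Proof.
pose i1 : ghom X dsum := fun l => row_mx 1%:M 0.
pose i2 : ghom Y dsum := fun l => row_mx 0 1%:M.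
pose p1 : ghom dsum X := fun l => col_mx 1%:M 0.
pose p2 : ghom dsum Y := fun l => col_mx 0 1%:M.
have [hid1 _] := idh_hom X; have [hid2 _] := idh_hom Y.
exists i1, i2, p1, p2; split.
- split; last split; last split; split=> [l s t|k l].
  + rewrite /i1 /=; case: (split_ordP t) => w ->.
      by rewrite row_mxEl sum_degl; exact: hid1.
    by rewrite row_mxEr mxE; exact: homog0.
  + by rewrite /i1 /= mul_row_block mul_mx_row !mulmx0 !mul0mx !addr0 mul1mx mulmx1.
  + rewrite /i2 /=; case: (split_ordP t) => w ->.
      by rewrite row_mxEl mxE; exact: homog0.
    by rewrite row_mxEr sum_degr; exact: hid2.
  + by rewrite /i2 /= mul_row_block mul_mx_row !mulmx0 !mul0mx !add0r mul1mx mulmx1.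
  + rewrite /p1 /=; case: (split_ordP s) => w ->.
      by rewrite col_mxEu sum_degl; exact: hid1.
    by rewrite col_mxEd mxE; exact: homog0.
  + by rewrite /p1 /= mul_block_col mul_col_mx !mulmx0 !mul0mx !addr0 mul1mx mulmx1.
  + rewrite /p2 /=; case: (split_ordP s) => w ->.
      by rewrite col_mxEu mxE; exact: homog0.
    by rewrite col_mxEd sum_degr; exact: hid2.
  + by rewrite /p2 /= mul_block_col mul_col_mx !mulmx0 !mul0mx !add0r mul1mx mulmx1.
- apply: functional_extensionality_dep => l.
  by rewrite /comp /i1 /p1 mul_row_col mulmx0 addr0 mulmx1.
- apply: functional_extensionality_dep => l.
  by rewrite /comp /i2 /p2 mul_row_col mulmx0 add0r mulmx1.
- split; apply: functional_extensionality_dep => l;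
  by rewrite /comp /i1 /i2 /p1 /p2 mul_row_col ?mulmx0 ?mul0mx addr0.
apply: functional_extensionality_dep => l.
rewrite /addh /comp /i1 /i2 /p1 /p2 !mul_col_row !mulmx0 !mul0mx !mulmx1.
by rewrite add_block_mx !addr0 !add0r -scalar_mx_block.
Qed.

End DirectSum.

(** * The exact sequence of a square of modules (a,b) *)

Section Squares.
Variables (K : fieldType) (n : nat) (o : 'I_n).
Hypothesis hn : (3 <= n)%N.
Implicit Types (X Y Z : gmod K n) (a b : int).

Notation jmod := (@jmod K n).

Definition jdeg a b (l : 'I_n) : int := jbase a b l - jshift n a b.

Lemma jdeg_le (l : 'I_n) (d : int) : exists (e : bool) (k q : int),
  d = (nat_of_bool e)%:Z - 2 * q /\
  forall a b, valid n a b -> (jdeg a b l <= d) = (k <= if e then b else a).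
Proof.
have [e [k [<- <-]]] := vtx_fdeg_ex o hn l d.
by exists e, k, (divz (k - 1) n%:Z); split=> // a b hab; rewrite -(@jmod_deg n o hn a b e k hab).
Qed.

(* At each vertex one of the two steps of the square is an equality: the even
   degrees only see the first coordinate, the odd degrees only the second. *)
Lemma jdeg_square s s' t t' (l : 'I_n) : s < s' -> s' < t -> t < t' -> t' < s + n%:Z ->
  let: (al, be, ga, de) := (jdeg s t l, jdeg s t' l, jdeg s' t l, jdeg s' t' l) in
  [/\ al - be = ga - de, al - ga = be - de, be <= al, ga <= al & al = be \/ al = ga].
Proof.
move=> h1 h2 h3 h4.
have v1 : valid n s t by rewrite /valid; lia.
have v2 : valid n s t' by rewrite /valid; lia.
have v3 : valid n s' t by rewrite /valid; lia.
have v4 : valid n s' t' by rewrite /valid; lia.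
have H d : exists q, (d = 2 * q /\ (jdeg s t' l <= d) = (jdeg s t l <= d) /\
                   (jdeg s' t l <= d) = (jdeg s' t' l <= d)) \/
               (d = 2 * q + 1 /\ (jdeg s' t l <= d) = (jdeg s t l <= d) /\
                   (jdeg s t' l <= d) = (jdeg s' t' l <= d)).
  have [e [k [q [hd h]]]] := jdeg_le l d; exists (- q); rewrite !h //.
  by case: e hd {h} => /= hd; [right | left]; split=> //; lia.
have mono a b c d : valid n a b -> valid n c d -> a <= c -> b <= d ->
    jdeg c d l <= jdeg a b l.
  move=> hab hcd hac hbd; have [e [k [q [_ h]]]] := jdeg_le l (jdeg a b l).
  have := h _ _ hab; rewrite lexx h // => /esym; case: (e); lia.
have m1 := mono _ _ _ _ v1 v2 (lexx s) (ltW h3).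
have m2 := mono _ _ _ _ v1 v3 (ltW h1) (lexx t).
have m3 := mono _ _ _ _ v2 v4 (ltW h1) (lexx t').
have m4 := mono _ _ _ _ v3 v4 (lexx s') (ltW h3).
(* Two consecutive degrees from the lowest corner on meet both parities, which bounds the highest
   corner by the lowest plus 1. *)
have [q1 H1] := H (jdeg s' t' l); have [q2 H2] := H (jdeg s' t' l + 1).
have [q3 H3] := H (jdeg s t l - 1).
move: (jdeg s t l) (jdeg s t' l) (jdeg s' t l) (jdeg s' t' l) m1 m2 m3 m4 H1 H2 H3.
move=> al be ga de m1 m2 m3 m4 H1 H2 H3 {H mono}.
by case: H1 => [] [e1 [f1 g1]]; case: H2 => [] [e2 [f2 g2]]; case: H3 => [] [e3 [f3 g3]];
   split; lia.
Qed.

Lemma ev_jmod_act a b (k l : 'I_n) : ev (act (jmod a b) k l) = 1%:M.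
Proof.
apply/matrixP=> p q; rewrite !mxE /horner_eval hornerXn expr1n.
by rewrite (ord1 p) (ord1 q) eqxx.
Qed.

Lemma hom_jmodE a b c d (F : ghom (jmod a b) (jmod c d)) (l : 'I_n) :
  valid n a b -> valid n c d -> is_hom F -> fib o F = 1%:M ->
  F l = ('X^(absz (jdeg a b l - jdeg c d l)))%:M.
Proof.
move=> hab hcd hF hF1.
have := fib_at o l (jmod_cm hn hab) (jmod_cm hn hcd) hF.
rewrite hF1 /toO /fromO !ev_jmod_act !mulmx1 => /matrixP/(_ 0 0); rewrite !mxE /horner_eval => h.
apply/matrixP=> p q; rewrite mxE (ord1 p) (ord1 q) eqxx mulr1n.
have := homogE (hmx_hom l hF 0 0); case: ifP => _ e; rewrite e; first by rewrite h scale1r.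
by move: h; rewrite e horner0 => /esym/eqP; rewrite oner_eq0.
Qed.

Lemma square_ses s s' t t' : s < s' -> s' < t -> t < t' -> t' < s + n%:Z ->
  exists D (f : ghom (jmod s t) D) (g : ghom D (jmod s' t'))
    (i1 : ghom (jmod s t') D) (i2 : ghom (jmod s' t) D)
    (p1 : ghom D (jmod s t')) (p2 : ghom D (jmod s' t)),
  [/\ ses f g, is_biprod D (jmod s t') (jmod s' t),
      [/\ is_hom i1, is_hom i2, is_hom p1 & is_hom p2],
      [/\ fib o i1 *m fib o p1 = 1%:M, fib o i2 *m fib o p2 = 1%:M,
          fib o i1 *m fib o p2 = 0, fib o i2 *m fib o p1 = 0 &
          fib o p1 *m fib o i1 + fib o p2 *m fib o i2 = 1%:M] &
      fib o f = fib o i1 - fib o i2 :> 'rV_(rk D o) /\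
      fib o g = fib o p1 + fib o p2 :> 'cV_(rk D o)].
Proof.
move=> h1 h2 h3 h4.
have v1 : valid n s t by rewrite /valid; lia.
have v2 : valid n s t' by rewrite /valid; lia.
have v3 : valid n s' t by rewrite /valid; lia.
have v4 : valid n s' t' by rewrite /valid; lia.
have [c1 c2] := (jmod_cm (K := K) hn v1, jmod_cm (K := K) hn v2).
have [c3 c4] := (jmod_cm (K := K) hn v3, jmod_cm (K := K) hn v4).
have [F1 [hF1 fF1]] := jhom_ex K o hn v1 v2 (lexx s) (ltW h3).
have [F2 [hF2 fF2]] := jhom_ex K o hn v1 v3 (ltW h1) (lexx t).
have [G1 [hG1 fG1]] := jhom_ex K o hn v2 v4 (ltW h1) (lexx t').
have [G2 [hG2 fG2]] := jhom_ex K o hn v3 v4 (lexx s') (ltW h3).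
have hD := dsum_cm c2 c3; have hb := dsum_biprod (jmod s t') (jmod s' t).
set D := dsum _ _ in hD hb.
have [i1 [i2 [p1 [p2 [[hi1 [hi2 [hp1 hp2]]] e11 e22 [e12 e21] e]]]]] := hb.
exists D, (subh (comp F1 i1) (comp F2 i2)), (addh (comp p1 G1) (comp p2 G2)), i1, i2, p1, p2.
split=> //; last first.
- by rewrite fib_sub fib_add !fib_comp fF1 fF2 fG1 fG2 !mul1mx !mulmx1.
- by rewrite -!fib_comp e11 e22 e12 e21 !fib_id !fib_zero -(fib_id o D) -e fib_add.
(* Opposite sides of the square are the same power of x, so the maps are (x, -y) and (y, x); one of
   [x l] and [y l] being 1 makes the sequence exact at each vertex. *)
have [x [y hxy]] : exists x y : 'I_n -> {poly K},
    forall l, [/\ F1 l = (x l)%:M, G2 l = (x l)%:M, F2 l = (y l)%:M, G1 l = (y l)%:M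
               & x l = 1 \/ y l = 1].
  exists (fun l => 'X^(absz (jdeg s t l - jdeg s t' l))).
  exists (fun l => 'X^(absz (jdeg s t l - jdeg s' t l))) => l.
  have [q1 q2 _ _ q5] := jdeg_square l h1 h2 h3 h4.
  split; rewrite ?(hom_jmodE _ _ _ hF1) ?(hom_jmodE _ _ _ hF2) ?(hom_jmodE _ _ _ hG1) //.
  - by rewrite (hom_jmodE _ _ _ hG2) // q1.
  - by rewrite q2.
  - by case: q5 => ->; rewrite subrr ?expr0; [left | right].
have el (l : 'I_n) : [/\ i1 l *m p1 l = 1%:M, i2 l *m p2 l = 1%:M, i1 l *m p2 l = 0,
    i2 l *m p1 l = 0 & p1 l *m i1 l + p2 l *m i2 l = 1%:M].
  split.
  - by have := congr1 (fun H : ghom _ _ => H l) e11.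
  - by have := congr1 (fun H : ghom _ _ => H l) e22.
  - by have := congr1 (fun H : ghom _ _ => H l) e12.
  - by have := congr1 (fun H : ghom _ _ => H l) e21.
  - by have := congr1 (fun H : ghom _ _ => H l) e.
split=> [//|||l].
- by apply: subh_hom; apply: comp_hom.
- by apply: addh_hom; apply: comp_hom.
have [k11 k22 k12 k21 kk] := el l; have [rF1 rG2 rF2 rG1 rxy] := hxy l.
rewrite /subh /addh /comp rF1 rF2 rG1 rG2.
set P1 : 'cV[{poly K}]_(rk D l) := p1 l in k11 k22 k12 k21 kk *.
set P2 : 'cV[{poly K}]_(rk D l) := p2 l in k11 k22 k12 k21 kk *.
set I1 : 'rV[{poly K}]_(rk D l) := i1 l in k11 k22 k12 k21 kk *.
set I2 : 'rV[{poly K}]_(rk D l) := i2 l in k11 k22 k12 k21 kk *.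
rewrite [_ *m I1]mul_scalar_mx [_ *m I2]mul_scalar_mx.
rewrite [P1 *m _]mul_mx_scalar [P2 *m _]mul_mx_scalar.
have kf1 (u : 'rV_1) : u *m (x l *: I1 - y l *: I2) *m P1 = x l *: u.
  rewrite -mulmxA mulmxBl -!scalemxAl k11 k21 scaler0 subr0.
  by rewrite -scalemxAr mulmx1.
have kf2 (u : 'rV_1) : u *m (x l *: I1 - y l *: I2) *m P2 = - (y l *: u).
  rewrite -mulmxA mulmxBl -!scalemxAl k12 k22 scaler0 sub0r.
  by rewrite mulmxN -scalemxAr mulmx1.
split=> [v hv|w|v].
- have [] := (kf1 v, kf2 v); rewrite hv !mul0mx.
  case: rxy => ->; rewrite !scale1r; first by move=> [<-].
  by move=> [_ /esym/eqP]; rewrite oppr_eq0 => /eqP.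
- case: rxy => hx; rewrite hx scale1r.
    exists (w *m I2); rewrite -mulmxA mulmxDr -scalemxAr k21 k22 scaler0 add0r.
    exact: mulmx1.
  exists (w *m I1); rewrite -mulmxA mulmxDr -scalemxAr k11 k12 scaler0 addr0.
  exact: mulmx1.
split=> [hv|[u <-]]; last first.
  rewrite mulmxDr -!scalemxAr kf1 kf2 scalerN !scalerA mulrC.
  exact: subrr.
rewrite mulmxDr -!scalemxAr in hv.
have vE : v = (v *m P1) *m I1 + (v *m P2) *m I2.
  by rewrite -!mulmxA -mulmxDr kk mulmx1.
case: rxy => hx; rewrite hx scale1r in hv; rewrite hx scale1r.
  have hp2' : v *m P2 = - (y l *: (v *m P1)).
    by apply/eqP; rewrite -addr_eq0 addrC; apply/eqP; exact: hv.
  exists (v *m P1); rewrite mulmxBr [in RHS]vE hp2'.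
  by rewrite mulNmx -scalemxAr -scalemxAl.
have hp1' : v *m P1 = - (x l *: (v *m P2)).
  by apply/eqP; rewrite -addr_eq0; apply/eqP; exact: hv.
exists (- (v *m P2)); rewrite mulmxBr [in RHS]vE hp1'.
by rewrite !mulNmx -scalemxAr -scalemxAl opprK.
Qed.

End Squares.

(** * Almost split sequences *)

Section AlmostSplit.
Variables (K : fieldType) (n : nat) (o : 'I_n).
Hypothesis hn : (3 <= n)%N.
Implicit Types (X Y Z : gmod K n) (a b : int).

Notation jmod := (@jmod K n).

Lemma ar_sequence a b : a + 1 < b -> b < a + n%:Z - 1 ->
  exists D (f : ghom (jmod (a - 1) (b - 1)) D) (g : ghom D (jmod a b)),
    almost_split f g /\ is_biprod D (jmod (a - 1) b) (jmod a (b - 1)).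
Proof.
move=> h1 h2.
have v1 : valid n (a - 1) (b - 1) by rewrite /valid; lia.
have v2 : valid n (a - 1) b by rewrite /valid; lia.
have v3 : valid n a (b - 1) by rewrite /valid; lia.
have v4 : valid n a b by rewrite /valid; lia.
have [c1 c2] := (jmod_cm (K := K) hn v1, jmod_cm (K := K) hn v2).
have [c3 c4] := (jmod_cm (K := K) hn v3, jmod_cm (K := K) hn v4).
have [||||D [f [g [i1 [i2 [p1 [p2 [hs hb [hi1 hi2 hp1 hp2] hid [fE gE]]]]]]]]] :=
  @square_ses K n o hn (a - 1) a (b - 1) b; try lia.
have [e11 e22 e12 e21 e] := hid.
have [[_ [hD _]] hf hg _] := hs.
exists D, f, g; split=> //; split=> //; split.
- move=> [r [hr hfr]]; have := fib_comp o f r; rewrite hfr fib_id.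
  have z1 : (fib o i1 : 'rV_(rk D o)) *m fib o r = 0.
    by have <- := fib_comp o i1 r; apply: hom_jmod0 => //; [exact: comp_hom | lia].
  have z2 : (fib o i2 : 'rV_(rk D o)) *m fib o r = 0.
    by have <- := fib_comp o i2 r; apply: hom_jmod0 => //; [exact: comp_hom | lia].
  by rewrite [X in X *m _]fE mulmxBl z1 z2 subrr => /eqP; rewrite (negPf (mx1_neq0 K _)).
- move=> W h hW hh hns.
  have [w1 w2] := hom_fromP o hn v1 hW hh.
  have [p [q [wE pA qB]]] := nonsplit_mono_from o hn v1 hW hh hns.
  rewrite !subrK in pA qB.
  (* p lies in A_a, q in B_b, and p + q in both A_(a-1) and B_(b-1); hence p also lies in B_(b-1)
     and q in A_(a-1), and each defines a map out of one middle term. *)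
  have pB : fil o W true (b - 1) p.
    rewrite (_ : p = fib o h - q); last by rewrite [fib o h]wE addrK.
    by apply: filB => //; apply: fil_dec qB => //; lia.
  have qA : fil o W false (a - 1) q.
    rewrite (_ : q = fib o h - p); last by rewrite [fib o h]wE [p + q]addrC addrK.
    by apply: filB => //; apply: fil_dec pA => //; lia.
  have [k1 [hk1 k1E]] := hom_from hn v2 hW qA qB.
  have [k2 [hk2 k2E]] := hom_from hn v3 hW pA pB.
  have hh' : is_hom (subh (comp p1 k1) (comp p2 k2)) by apply: subh_hom; apply: comp_hom.
  exists (subh (comp p1 k1) (comp p2 k2)); split=> //.
  apply: (@fib_inj K n o) => //; first exact: comp_hom.
  rewrite fib_comp fib_sub !fib_comp [fib o f]fE [RHS]wE k1E k2E.
  rewrite mulmxBr !mulmxBl !mulmxA e11 e22 e12 e21 !mul1mx !mul0mx.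
  rewrite subr0 sub0r opprK; exact: addrC.
- move=> [r [hr hrg]]; have := fib_comp o r g; rewrite hrg fib_id.
  have z1 : fib o r *m (fib o p1 : 'cV_(rk D o)) = 0.
    by have <- := fib_comp o r p1; apply: hom_jmod0 => //; [exact: comp_hom | lia].
  have z2 : fib o r *m (fib o p2 : 'cV_(rk D o)) = 0.
    by have <- := fib_comp o r p2; apply: hom_jmod0 => //; [exact: comp_hom | lia].
  by rewrite [X in _ *m X]gE mulmxDr z1 z2 addr0 => /eqP; rewrite (negPf (mx1_neq0 K _)).
move=> W h hW hh hns.
have [hA hB] := hom_toP o hn v4 hW hh.
have h0 (v : 'rV_(rk W o)) := nonsplit_epi_to (v := v) hn v4 hW hh hns.
set phi : 'cV_(rk W o) := fib o h in hA hB h0.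
pose Fi := Fil o W.
(* phi1 kills A_a and B_(b+1) and agrees with phi on A_(a+1) and B_b; these
   demands are compatible because phi kills the intersection of A_a and B_b. *)
have [|phi1] := @solve_mulmx _ _ _ _
    (col_mx (col_mx (Fi false a) (Fi true (b + 1))) (col_mx (Fi false (a + 1)) (Fi true b)))
    (col_mx (col_mx 0 0) (col_mx (Fi false (a + 1) *m phi) (Fi true b *m phi))).
  move=> u; rewrite -[u]hsubmxK -[lsubmx u]hsubmxK -[rsubmx u]hsubmxK !mul_row_col.
  rewrite !mulmx0 !add0r [lsubmx _ *m (_ *m phi)]mulmxA [rsubmx _ *m (_ *m phi)]mulmxA.
  set p := lsubmx (lsubmx u) *m _; set q := rsubmx (lsubmx u) *m _.
  set r := lsubmx (rsubmx u) *m _; set z := rsubmx (rsubmx u) *m _ => huv.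
  have pA : fil o W false a p by rewrite filP // submxMl.
  have qB : fil o W true (b + 1) q by rewrite filP // submxMl.
  have rA : fil o W false (a + 1) r by rewrite filP // submxMl.
  have zB : fil o W true b z by rewrite filP // submxMl.
  rewrite (hA r) // add0r.
  have hz : z + q = - (p + r).
    by apply/eqP; rewrite -addr_eq0 -huv addrC [z + q]addrC addrACA.
  have : (z + q) *m phi = 0.
    apply: h0; last by apply: filD => //; apply: fil_dec qB => //; lia.
    rewrite hz -scaleN1r; apply: filZ => //; apply: filD => //.
    by apply: fil_dec rA => //; lia.
  by rewrite mulmxDl (hB q) // addr0.
rewrite !mul_col_mx => /eq_col_mx[/eq_col_mx[k1 k2] /eq_col_mx[k3 k4]].
have kill e' k v (psi : 'cV_(rk W o)) : Fi e' k *m psi = 0 -> fil o W e' k v -> v *m psi = 0.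
  by move=> hpsi; rewrite filP // => /submxP[y ->]; rewrite -mulmxA hpsi mulmx0.
have [H1 [hH1 H1E]] : exists H : ghom W (jmod (a - 1) b), is_hom H /\ fib o H = phi1.
  by apply: hom_to => // v; [rewrite subrK|]; apply: kill.
have [H2 [hH2 H2E]] : exists H : ghom W (jmod a (b - 1)), is_hom H /\ fib o H = phi - phi1.
  by apply: hom_to => // v; [|rewrite subrK]; apply: kill; rewrite mulmxBr ?k3 ?k4 subrr.
have hh' : is_hom (addh (comp H1 i1) (comp H2 i2)) by apply: addh_hom; apply: comp_hom.
exists (addh (comp H1 i1) (comp H2 i2)); split=> //.
apply: (@fib_inj K n o) => //; first exact: comp_hom.
rewrite fib_comp fib_add !fib_comp [fib o g]gE H1E H2E.
rewrite mulmxDr !mulmxDl -!mulmxA e11 e22 e12 e21 !mulmx1 !mulmx0.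
rewrite addr0 add0r addr0; exact: subrKC.
Qed.

Lemma jmod_projectiveE a b : valid n a b -> projectiveCM (jmod a b) ->
  b = a + 1 \/ b = a + n%:Z - 1.
Proof.
move=> hab [hJ hP]; have [/andP[h1 h2]|h] := boolP ((a + 1 < b) && (b < a + n%:Z - 1)).
  have [D [f [g [[hs _ [hns _]] _]]]] := ar_sequence h1 h2; case: hns.
  by have := hP _ _ _ _ _ hs _ (idh_hom _).
by move: h hab; rewrite /valid; lia.
Qed.

End AlmostSplit.

(** * Radical maps and the arrows of the quiver *)

Section Arrows.
Variables (K : fieldType) (n : nat) (o : 'I_n).
Hypothesis hn : (3 <= n)%N.
Implicit Types (X Y Z : gmod K n) (a b : int).

Notation jmod := (@jmod K n).

(** Nonzero maps can only raise the indices, so between distinct modules F and G are not both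
    nonzero and F G = 0. *)
Lemma jmod_rad a b c d (F : ghom (jmod a b) (jmod c d)) : valid n a b -> valid n c d ->
  (a != c) || (b != d) -> is_hom F -> in_rad F.
Proof.
move=> hab hcd hne hF; split=> // G hG.
have hJ := jmod_cm (K := K) hn hab.
have hFG : comp F G = zeroh _ _.
  apply: (@fib_inj K n o) => //; [exact: comp_hom | exact: zeroh_hom |].
  rewrite fib_comp fib_zero.
  have [h|/(hom_jmod0 o hn hab hcd hF) ->] := boolP ((a <= c) && (b <= d)).
    by rewrite (hom_jmod0 o hn hcd hab hG) ?mulmx0 //; lia.
  by rewrite mul0mx.
have e1 : subh (idh (jmod a b)) (comp F G) = idh (jmod a b).
  by rewrite hFG; apply: functional_extensionality_dep => l; rewrite /subh subr0.
exists (idh (jmod a b)); rewrite e1; split; first exact: idh_hom.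
  by apply: functional_extensionality_dep => l; rewrite /comp mulmx1.
by apply: functional_extensionality_dep => l; rewrite /comp mulmx1.
Qed.

Lemma jmod_rad_diag a b (F : ghom (jmod a b) (jmod a b)) : valid n a b ->
  in_rad F -> fib o F = 0.
Proof.
move=> hab hF; apply/eqP; apply: contraT => h; exfalso.
have hJ := jmod_cm (K := K) hn hab.
apply: (rad_nonsplit_mono (o := o) _ hF) => //.
set v : 'M[K]_1 := fib o F in h.
have vE : v = (v 0 0)%:M by exact: mx11_scalar.
have v0 : v 0 0 != 0 by apply: contraNneq h => h0; rewrite vE h0 raddf0.
have hG := scaleh_hom (v 0 0)^-1 (idh_hom (jmod a b)).
exists (scaleh (v 0 0)^-1 (idh (jmod a b))); split=> //.
apply: (@fib_split K n o) => //; first by case: hF.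
rewrite fib_scale fib_id -scalemxAr mulmx1 (_ : fib o F = (v 0 0)%:M); last exact: vE.
by rewrite scale_scalar_mx mulVf.
Qed.

Lemma hom_jmod_scale a b c d (F F0 : ghom (jmod a b) (jmod c d)) : valid n a b -> valid n c d ->
  is_hom F -> is_hom F0 -> fib o F0 = 1%:M -> exists x, F = scaleh x F0.
Proof.
move=> hab hcd hF hF0 e; exists ((fib o F : 'M_1) 0 0).
apply: (@fib_inj K n o) => //; try exact: jmod_cm.
  exact: scaleh_hom.
rewrite fib_scale e scalemx1; exact: mx11_scalar.
Qed.

Lemma in_rad2_zeroh X Y : in_rad2 (zeroh X Y).
Proof.
exists 0%N, (fun _ => X), (fun _ => zeroh X X), (fun _ => zeroh X Y); split; first by case.
by apply: functional_extensionality_dep => l; rewrite big_ord0.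
Qed.

Lemma rad2_arrow0 a b c d (F : ghom (jmod a b) (jmod c d)) : valid n a b -> valid n c d ->
  (c == a + 1) && (d == b) || (c == a) && (d == b + 1) -> in_rad2 F -> fib o F = 0.
Proof.
move=> hab hcd hac [m [Z [f1 [f2 [hZ ->]]]]]; rewrite /fib raddf_sum big1 // => i _ /=.
rewrite map_mxM -/(fib o (f1 i)) -/(fib o (f2 i)).
have [hZi r1 r2] := hZ i; have [hf1 _] := r1; have [hf2 _] := r2.
have ns1 := rad_nonsplit_mono (isT : (0 < rk (jmod a b) o)%N) r1.
have ns2 := rad_nonsplit_epi (isT : (0 < rk (jmod c d) o)%N) r2.
have [zA zB] := hom_fromP o hn hab hZi hf1.
have [p [q [zE pA qB]]] := nonsplit_mono_from o hn hab hZi hf1 ns1.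
have [kA kB] := hom_toP o hn hcd hZi hf2.
have k0 (v : 'rV_(rk (Z i) o)) := nonsplit_epi_to (v := v) hn hcd hZi hf2 ns2.
have pB : fil o (Z i) true b p.
  rewrite (_ : p = fib o (f1 i) - q); last by rewrite [fib o (f1 i)]zE addrK.
  by apply: filB => //; apply: fil_dec qB => //; lia.
have qA : fil o (Z i) false a q.
  rewrite (_ : q = fib o (f1 i) - p); last by rewrite [fib o (f1 i)]zE [p + q]addrC addrK.
  by apply: filB => //; apply: fil_dec pA => //; lia.
(* One of p and q lies in A_(c+1) or B_(d+1), the other in the intersection of A_c and B_d; the
   functional kills both kinds of vectors. *)
rewrite [fib o (f1 i)]zE; case/orP: hac => /andP[/eqP ec /eqP ed]; subst c d;
  by rewrite mulmxDl ?(kB q qB) ?(kA p pA) k0 // ?add0r ?addr0.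
Qed.

Lemma irr_dim1_arrow a b c d : valid n a b -> valid n c d ->
  (c == a + 1) && (d == b) || (c == a) && (d == b + 1) ->
  irr_dim1 (jmod a b) (jmod c d).
Proof.
move=> hab hcd hac.
have [||F0 [hF0 e0]] := jhom_ex K o hn hab hcd; try lia.
exists F0; split; first by apply: jmod_rad => //; lia.
  by move/(rad2_arrow0 hab hcd hac)/eqP; rewrite e0 (negPf (mx1_neq0 K _)).
move=> F [hF _]; have [x ->] := hom_jmod_scale hab hcd hF hF0 e0.
exists x; suff -> : subh (scaleh x F0) (scaleh x F0) = zeroh _ _ by exact: in_rad2_zeroh.
by apply: functional_extensionality_dep => l; rewrite /subh subrr.
Qed.

Lemma irr_dim0_nonarrow a b c d : valid n a b -> valid n c d ->
  ~~ ((c == a + 1) && (d == b) || (c == a) && (d == b + 1)) ->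
  irr_dim0 (jmod a b) (jmod c d).
Proof.
move=> hab hcd hac F hF; have [hF' _] := hF.
have zero_case : fib o F = 0 -> in_rad2 F.
  move=> h; suff -> : F = zeroh _ _ by exact: in_rad2_zeroh.
  apply: (@fib_inj K n o) => //; try exact: jmod_cm.
    exact: zeroh_hom.
  by rewrite fib_zero.
have [hle|/(hom_jmod0 o hn hab hcd hF')] := boolP ((a <= c) && (b <= d)); last by [].
have [hne|heq] := boolP ((a != c) || (b != d)); last first.
  have [ea eb] : a = c /\ b = d by move: heq; lia.
  by subst c d; apply: zero_case; apply: jmod_rad_diag.
have [e [g [veg h1 h2 h3 h4]]] : exists e g, [/\ valid n e g,
    (a <= e) && (b <= g), (e <= c) && (g <= d), (a != e) || (b != g) & (e != c) || (g != d)].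
  (* If b = a + 1 the module (a+1,b) does not exist; then (a,b+1) does, because n >= 3, and c > a
     forces d >= b + 1. *)
  have [h|h] := boolP ((a < c) && (a + 1 < b)).
    by exists (a + 1), b; move: hab hcd; rewrite /valid => *; split; lia.
  by exists a, (b + 1); move: hab hcd; rewrite /valid => *; split; lia.
have [/andP[h11 h12] /andP[h21 h22]] := (h1, h2).
have [F1 [hF1 e1]] := jhom_ex K o hn hab veg h11 h12.
have [F2 [hF2 e2]] := jhom_ex K o hn veg hcd h21 h22.
have hF12 := comp_hom hF1 hF2.
have [|x ->] := hom_jmod_scale hab hcd hF' hF12; first by rewrite fib_comp e1 e2 mulmx1.
exists 1%N, (fun _ => jmod e g), (fun _ => scaleh x F1), (fun _ => F2); split=> [_|].
  split; [exact: jmod_cm | | exact: jmod_rad].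
  by apply: jmod_rad => //; apply: scaleh_hom.
by apply: functional_extensionality_dep => l; rewrite big_ord1 /scaleh /comp scalemxAl.
Qed.

End Arrows.

(** * Non-split extensions of indecomposables *)

Section Extensions.
Variables (K : fieldType) (n : nat) (o : 'I_n).
Hypothesis hn : (3 <= n)%N.

Notation jmod := (@jmod K n).

Lemma filM1 (X : gmod K n) e k (c : 'M[K]_1) u : is_cm X -> fil o X e k u -> fil o X e k (c *m u).
Proof. by move=> hX hu; rewrite [c]mx11_scalar mul_scalar_mx; apply: filZ. Qed.

Lemma filM1E (X : gmod K n) e k (c : 'M[K]_1) u : is_cm X -> c != 0 ->
  fil o X e k (c *m u) -> fil o X e k u.
Proof.
move=> hX hc; rewrite [c]mx11_scalar mul_scalar_mx; apply: filZE => //.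
by apply: contraNneq hc => h0; rewrite [c]mx11_scalar h0 raddf0.
Qed.

Lemma cV_rV1_inj m (c : 'cV[K]_m) r (u : 'rV[K]_r) : u != 0 -> c *m u = 0 -> c = 0.
Proof. by move=> hu /cV_rV0[//|/eqP]; rewrite (negPf hu). Qed.

(** The generator of C lifts to [v1] in A_(s') and to [v2] in B_(t'), by strictness for each
    filtration separately. They differ by a multiple [d] of the generator [u] of A, the obstruction
    to a common lift. If [d] is nonzero, the four inequalities follow, and [v2] and [v1] span the
    two summands. *)
Lemma nonsplit_extension (A B C : gmod K n) (f : ghom A B) (g : ghom B C) :
  ses f g -> indec A -> indec C -> ~ split_mono f ->
  exists s s' t t' : int,
    [/\ s < s' /\ s' < t /\ t < t' /\ t' < s + n%:Z,
        iso A (jmod s t), iso C (jmod s' t') & is_biprod B (jmod s t') (jmod s' t)].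
Proof.
move=> hs iA iC hns.
have [[hA [hB hC]] hf hg _] := hs.
have [s [t [vst isoA]]] := indec_iso_jmod o hn iA.
have [s' [t' [vst' isoC]]] := indec_iso_jmod o hn iC.
exists s, s', t, t'.
have [a1 [a2 [ha1 ha2 a12 a21]]] := isoA; have [c1 [c2 [hc1 hc2 c12 c21]]] := isoC.
have fa12 : fib o a1 *m fib o a2 = 1%:M by rewrite -fib_comp a12 fib_id.
have fa21 : fib o a2 *m fib o a1 = 1%:M by rewrite -fib_comp a21 fib_id.
have fc12 : fib o c1 *m fib o c2 = 1%:M by rewrite -fib_comp c12 fib_id.
have fc21 : fib o c2 *m fib o c1 = 1%:M by rewrite -fib_comp c21 fib_id.
have hJ := jmod_cm (K := K) hn vst; have hJ' := jmod_cm (K := K) hn vst'.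
have [u uD] : exists u : 'rV_(rk B o), u = fib o a2 *m fib o f by eexists.
have [pi piD] : exists pi : 'cV_(rk B o), pi = fib o g *m fib o c1 by eexists.
have fE : fib o f = fib o a1 *m u by rewrite uD mulmxA fa12 mul1mx.
have upi : u *m pi = 0.
  by rewrite uD piD mulmxA -[_ *m fib o f *m _]mulmxA (ses_comp0 o hs) mulmx0 mul0mx.
have u0 : u != 0.
  apply/eqP; rewrite uD => /(ses_inj (v := fib o a2) hs) h; have /eqP := fa21.
  by rewrite h mul0mx eq_sym (negPf (mx1_neq0 K _)).
have [uA uB] : fil o B false s u /\ fil o B true t u.
  have -> : u = fib o (comp a2 f) by rewrite fib_comp uD.
  by apply: hom_fromP => //; apply: comp_hom.
have pi_ker (v : 'rV_(rk B o)) : v *m pi = 0 -> v *m fib o g = 0.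
  by move=> h; rewrite -[LHS]mulmx1 -fc12 mulmxA -[v *m _ *m _]mulmxA -piD h mul0mx.
have u_fil e k : fil o B e k u -> k <= if e then t else s.
  move=> hu; have [y hy hyf] := ses_ker hs hu (pi_ker _ upi).
  have := fil_hom hA hJ ha1 hy; rewrite fil_jmod // => /orP[/eqP h|//].
  have : u = 0 by rewrite -hyf fE mulmxA h mul0mx.
  by move/eqP; rewrite (negPf u0).
have [piA piB] : (forall v, fil o B false (s' + 1) v -> v *m pi = 0) /\
                 (forall v, fil o B true (t' + 1) v -> v *m pi = 0).
  have -> : pi = fib o (comp g c1) by rewrite fib_comp piD.
  by apply: hom_toP => //; apply: comp_hom.
have pi_fil e k v : (if e then t' else s') < k -> fil o B e k v -> v *m pi = 0.
  by case: e => hk hv; [apply: piB | apply: piA]; apply: fil_dec hv => //; move: hk; clear; lia.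
have [c2A c2B] := hom_fromP o hn vst' hC hc2.
have [v1 v1A v1g] := ses_surj hs c2A; have [v2 v2B v2g] := ses_surj hs c2B.
have {}v1A : fil o B false s' v1 by [].
have {}v2B : fil o B true t' v2 by [].
have v1pi : v1 *m pi = 1%:M by rewrite piD mulmxA v1g.
have v2pi : v2 *m pi = 1%:M by rewrite piD mulmxA v2g.
(* Each lift v of the generator of C splits the fibre of B as K v + K u. *)
have coord v : v *m pi = 1%:M -> exists lam : 'cV_(rk B o),
    [/\ pi *m v + lam *m u = 1%:M, u *m lam = 1%:M, v *m lam = 0 &
        forall e k w, fil o B e k w -> w *m pi = 0 \/ fil o B e k v ->
          (if e then t else s) < k -> w *m lam = 0].
  move=> vpi; have hsub : (1%:M - pi *m v <= u)%MS.
    apply/row_subP => i; have h0 : row i (1%:M - pi *m v) *m pi = 0.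
      by rewrite -row_mul mulmxBl mul1mx -mulmxA vpi mulmx1 subrr row0.
    have [y <-] := ses_kerT hs (pi_ker _ h0).
    by apply/submxP; exists (y *m fib o a1); rewrite -mulmxA -fE.
  exists ((1%:M - pi *m v) *m pinvmx u); set lam := _ *m pinvmx u.
  have lamE : pi *m v + lam *m u = 1%:M by rewrite /lam mulmxKpV // addrC subrK.
  have wE (w : 'rV_(rk B o)) : w = w *m pi *m v + w *m lam *m u.
    by rewrite -[w *m pi *m v]mulmxA -[w *m lam *m u]mulmxA -mulmxDr lamE mulmx1.
  split=> //.
  - apply/eqP; rewrite -subr_eq0; apply/eqP; apply: (cV_rV1_inj u0).
    have h := wE u; rewrite upi mul0mx add0r in h.
    by rewrite mulmxBl mul1mx -h subrr.
  - apply: (cV_rV1_inj u0); apply: (addrI v).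
    have h := wE v; rewrite vpi mul1mx in h.
    by rewrite addr0 -h.
  move=> e k w hw hv hk; apply/eqP; apply: contraT => hl.
  suff /u_fil h : fil o B e k u by rewrite ltNge h in hk.
  apply: (filM1E hB hl); rewrite (_ : _ *m u = w - w *m pi *m v).
    case: hv => hv; first by rewrite hv mul0mx subr0.
    by apply: filB => //; apply: filM1.
  by rewrite [X in _ = X - _]wE addrC addKr.
(* A lift deep enough in both filtrations makes its complementary coordinate [lam] a filtered map,
   hence a retraction of [f]. *)
have nosplit v : fil o B false s' v -> fil o B true t' v -> v *m pi = 1%:M -> False.
  move=> vA vB vpi; have [lam [_ ulam _ lam0]] := coord v vpi.
  have lam_fil e k w : fil o B e k w -> (if e then t else s) < k -> w *m lam = 0.
    move=> hw hk; apply: (lam0 e k) => //.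
    have [hle|hlt] := leP k (if e then t' else s').
      by right; case: e hle {hw hk} => hle; [apply: fil_dec vB|apply: fil_dec vA].
    by left; apply: pi_fil hw.
  have [r [hr rE]] : exists r : ghom B (jmod s t), is_hom r /\ fib o r = lam.
    by apply: hom_to => // w hw; apply: (lam_fil _ _ _ hw); rewrite ltrDl.
  apply: hns; exists (comp r a2); split; first exact: comp_hom.
  apply: (@fib_split K n o) => //; first exact: comp_hom.
  by rewrite fib_comp rE fE -mulmxA [u *m (_ *m _)]mulmxA ulam mul1mx.
have [l1 [l1E ul1 v1l1 l1_0]] := coord v1 v1pi.
have [l2 [l2E ul2 v2l2 l2_0]] := coord v2 v2pi.
pose d : K := (v2 *m l1 : 'M_1) 0 0.
have v2l1 : v2 *m l1 = d%:M by exact: mx11_scalar.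
have v2E : v2 = v1 + d *: u.
  by rewrite -[LHS]mulmx1 -l1E mulmxDr !mulmxA v2pi v2l1 mul1mx mul_scalar_mx.
have v1E : v1 = v2 - d *: u by rewrite v2E addrK.
have d0 : d != 0.
  apply/eqP => h; apply: (nosplit v1) => //.
  by rewrite (_ : v1 = v2) // v2E h scale0r addr0.
have hss : s < s'.
  rewrite ltNge; apply/negP => hle; apply: (nosplit v2) => //.
  by rewrite v2E; apply: filD => //; apply: filZ => //; apply: fil_dec uA.
have htt : t < t'.
  rewrite ltNge; apply/negP => hle; apply: (nosplit v1) => //.
  by rewrite v1E; apply: filB => //; apply: filZ => //; apply: fil_dec uB.
(* If t <= s', both lifts lie in B_(t+1); if t' >= s + n, both lie in A_(s+1). Either puts [u]
   deeper than [u_fil] allows. *)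
have uE : d *: u = v2 - v1 by rewrite v2E addrC addKr.
have hst : s' < t.
  rewrite ltNge; apply/negP => hle.
  have /u_fil /= : fil o B true (t + 1) u; last by clear; lia.
  apply: (filZE hB d0); rewrite uE; apply: filB => //.
    by apply: fil_dec v2B => //; move: hle hss htt; clear; lia.
  by apply: fil_dec (fil_AB hn hB v1A) => //; move: hle hss htt; clear; lia.
have hts : t' < s + n%:Z.
  rewrite ltNge; apply/negP => hle.
  have /u_fil /= : fil o B false (s + 1) u; last by clear; lia.
  apply: (filZE hB d0); rewrite uE; apply: filB => //.
    by apply: fil_BA => //; apply: fil_dec v2B => //; move: hle hss htt; clear; lia.
  by apply: fil_dec v1A => //; move: hle hss htt; clear; lia.
split=> //.
have va : valid n s t' by move: hss hst htt hts; rewrite /valid; clear; lia.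
have vb : valid n s' t by move: hss hst htt hts; rewrite /valid; clear; lia.
have hJa := jmod_cm (K := K) hn va; have hJb := jmod_cm (K := K) hn vb.
have v2A : fil o B false s v2.
  by rewrite v2E; apply: filD => //; [apply: fil_dec v1A => //; move: hss htt; clear; lia | apply: filZ].
have v1B : fil o B true t v1.
  by rewrite v1E; apply: filB => //; [apply: fil_dec v2B => //; move: hss htt; clear; lia | apply: filZ].
have [i1 [hi1 i1E]] := hom_from hn va hB v2A v2B.
have [i2 [hi2 i2E]] := hom_from hn vb hB v1A v1B.
(* [d^-1 *: l1] and [- d^-1 *: l2] form the dual basis of [v2], [v1]: [l1] kills [v1] and takes the
   value d on [v2], while [l2] kills [v2] and takes the value -d on [v1]. *)
have [p1 [hp1 p1E]] : exists p : ghom B (jmod s t'), is_hom p /\ fib o p = d^-1 *: l1.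
  apply: hom_to => // w hw; rewrite -scalemxAr (l1_0 _ _ _ hw) ?scaler0 //=; try (by move: hss htt; clear; lia).
    by right; apply: fil_dec v1A => //; move: hss htt; clear; lia.
  by left; apply: pi_fil hw; move: hss htt; clear; lia.
have [p2 [hp2 p2E]] : exists p : ghom B (jmod s' t), is_hom p /\ fib o p = - d^-1 *: l2.
  apply: hom_to => // w hw; rewrite -scalemxAr (l2_0 _ _ _ hw) ?scaler0 //=; try (by move: hss htt; clear; lia).
    by left; apply: pi_fil hw; move: hss htt; clear; lia.
  by right; apply: fil_dec v2B => //; move: hss htt; clear; lia.
have l12 : l1 = d *: pi + l2.
  apply/eqP; rewrite -subr_eq0; apply/eqP; apply: (cV_rV1_inj u0).
  have := l1E; rewrite -l2E v2E mulmxDr -addrA => /addrI h.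
  by rewrite mulmxBl h mulmxDl -scalemxAl -scalemxAr subrr.
have v1l2 : v1 *m l2 = (- d)%:M.
  by rewrite v1E mulmxBl v2l2 -scalemxAl ul2 scalemx1 sub0r raddfN.
exists i1, i2, p1, p2; split=> //.
- apply: (@fib_split K n o) => //.
  by rewrite i1E p1E -scalemxAr v2l1 scale_scalar_mx mulVf.
- apply: (@fib_split K n o) => //.
  by rewrite i2E p2E -scalemxAr v1l2 scale_scalar_mx mulrNN mulVf.
- split; apply: (@fib_inj K n o) => //; try exact: comp_hom; try exact: zeroh_hom.
    by rewrite fib_comp fib_zero i1E p2E -scalemxAr v2l2 scaler0.
  by rewrite fib_comp fib_zero i2E p1E -scalemxAr v1l1 scaler0.
apply: (@fib_inj K n o) => //; [by apply: addh_hom; apply: comp_hom | exact: idh_hom |].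
rewrite fib_add !fib_comp fib_id i1E i2E p1E p2E -!scalemxAl.
have e1 : d^-1 *: (l1 *m v2) = d^-1 *: (l1 *m v1) + l1 *m u.
  by rewrite v2E mulmxDr -scalemxAr scalerDr scalerA mulVf // scale1r.
have e2 : d^-1 *: (l1 *m v1) = pi *m v1 + d^-1 *: (l2 *m v1).
  by rewrite {1}l12 mulmxDl -scalemxAl scalerDr scalerA mulVf // scale1r.
rewrite [d^-1 *: _]e1 e2 scaleNr -l1E addrAC.
by rewrite addrK.
Qed.

End Extensions.

Theorem theorem4p3 (K : fieldType) (n : nat) (hn : (3 <= n)%N) :
  let M := @mod_ab K n in
  [/\ (* (1) classification of indecomposables, projective-injectives *)
      [/\ forall a b : int, 0 < b - a < n%:Z -> indec (M a b),
          forall a b a' b' : int, 0 < b - a < n%:Z -> 0 < b' - a' < n%:Z ->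
            iso (M a b) (M a' b') -> a = a' /\ b = b',
          forall X : gmod K n, indec X ->
            exists a b : int, 0 < b - a < n%:Z /\ iso X (M a b)
        & forall a b : int, 0 < b - a < n%:Z ->
            (projectiveCM (M a b) /\ injectiveCM (M a b) <->
             b = a + 1 \/ b = a + n%:Z - 1)],
      (* (2) non-split extensions *)
      forall (A B C : gmod K n) (f : ghom A B) (g : ghom B C),
        ses f g -> indec A -> indec C -> ~ split_mono f ->
        exists s s' t t' : int,
          [/\ s < s' /\ s' < t /\ t < t' /\ t' < s + n%:Z,
              iso A (M s t), iso C (M s' t') & is_biprod B (M s t') (M s' t)],
      (* (3) Auslander-Reiten sequences *)
      forall i j : int, 0 < j - i < n%:Z -> ~ projectiveCM (M i j) ->
        exists (A B : gmod K n) (f : ghom A B) (g : ghom B (M i j)),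
          [/\ almost_split f g, iso A (M (i - 1) (j - 1))
            & is_biprod B (M (i - 1) j) (M i (j - 1))]
    & (* (4) arrows of the Auslander-Reiten quiver *)
      forall a b c d : int, 0 < b - a < n%:Z -> 0 < d - c < n%:Z ->
        if ((c == a + 1) && (d == b)) || ((c == a) && (d == b + 1))
        then irr_dim1 (M a b) (M c d)
        else irr_dim0 (M a b) (M c d)].
Proof.
have E : @mod_ab K n = @jmod K n.
  by do 2!apply: functional_extensionality_dep => ?; apply: mod_abE.
move=> M; rewrite {}/M E.
have o : 'I_n by exists 0%N; lia.
split; first split.
- by move=> a b; apply: jmod_indec.
- by move=> a b a' b'; apply: jmod_iso_inj.
- by move=> X /(indec_iso_jmod o hn).
- move=> a b hab; split=> [[/(jmod_projectiveE o hn hab)] //|hb].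
  by split; [apply: jmod_projective | apply: jmod_injective].
- by move=> A B C f g; apply: nonsplit_extension.
- move=> i j hij hnp.
  have [||D [f [g [hfg hb]]]] := @ar_sequence K n o hn i j.
  + by rewrite ltNge; apply/negP => h; apply: hnp; apply: jmod_projective => //; lia.
  + by rewrite ltNge; apply/negP => h; apply: hnp; apply: jmod_projective => //; lia.
  exists (jmod K n (i - 1) (j - 1)), D, f, g; split=> //.
  exists (idh _), (idh _); split; try exact: idh_hom;
  by apply: functional_extensionality_dep => l; rewrite /comp mulmx1.
move=> a b c d hab hcd; case: ifP => h; first exact: irr_dim1_arrow.
by apply: irr_dim0_nonarrow => //; rewrite h.
Qed.
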